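(* Let $n\ge 1$ be an integer, let $\Omega$ be an open subset of $\mathbb{R}$ and let $k:\Omega^2\to\mathbb{C}$ be a positive definite kernel on $\Omega$. If $k$ is of class $\mathcal{S}_n(\mathcal{U})$ for some open subset $\mathcal{U}\subseteq\Omega^2$ containing the diagonal $\mathcal{D}(\Omega^2)=\{(x,x):x\in\Omega\}$, then $k$ is of class $\mathcal{S}_n(\Omega^2)$.
   Context: A function $k:\Omega\times\Omega\to\mathbb{C}$ is a positive definite kernel on a nonempty set $\Omega$ if, for every $m\in\mathbb{N}$ and all finite collections $\{x_j\}_{j=1}^m\subset\Omega$ and $\{\xi_j\}_{j=1}^m\subset\mathbb{C}$, one has $\sum_{i,j=1}^m k(x_i,x_j)\,\xi_i\,\overline{\xi_j}\ge 0$. For an open set $\mathcal{U}\subset\mathbb{R}^2$, a function $k:\mathcal{U}\to\mathbb{C}$ is of class $\mathcal{S}_n(\mathcal{U})$ if, for every $m_1=0,1,\dots,n$ and $m_2=0,1,\dots,n$, the partial derivatives $\frac{\partial^{m_1+m_2}}{\partial v^{m_2}\,\partial u^{m_1}}k(u,v)$ (exist and) are continuous in $\mathcal{U}$. For a function defined on a larger set, being of class $\mathcal{S}_n(\mathcal{U})$ refers to its restriction to $\mathcal{U}$. *)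

(* Defs.v *)
From Stdlib Require Import Reals.
From Coquelicot Require Import Coquelicot.

Open Scope R_scope.

(* Functions on a subset of R or R^2 are represented by total functions; every
   notion below only looks at the values on the relevant (open) set. *)

Definition diagonal (Omega : R -> Prop) : R * R -> Prop :=
  fun p => Omega (fst p) /\ snd p = fst p.

Definition square (Omega : R -> Prop) : R * R -> Prop :=
  fun p => Omega (fst p) /\ Omega (snd p).

(* The order of the complex numbers: z >= 0 means that z is real and
   nonnegative. *)
Definition Cnonneg (z : C) : Prop := 0 <= Re z /\ Im z = 0.

Definition positive_definite_kernel (Omega : R -> Prop) (k : R -> R -> C) : Prop :=
  forall (m : nat) (x : nat -> R) (xi : nat -> C),
    (forall j, (1 <= j <= m)%nat -> Omega (x j)) ->
    Cnonneg
      (sum_n_m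
         (fun i =>
            sum_n_m (fun j => (k (x i) (x j) * xi i * Cconj (xi j))%C) 1 m)
         1 m).

(* Derivative of a complex-valued function of a real variable. Like [Derive], it
   is total, and is meaningful only where [f] is differentiable. *)
Definition RCDerive (f : R -> C) (x : R) : C :=
  (Derive (fun t => Re (f t)) x, Derive (fun t => Im (f t)) x).

Lemma RCDerive_correct (f : R -> C) (x : R) :
  ex_derive (V := C_R_NormedModule) f x ->
  is_derive (V := C_R_NormedModule) f x (RCDerive f x).
Proof.
  intros [l Hl].
  assert (H1 : is_derive (fun t => Re (f t)) x (fst l)).
  { refine (filterdiff_comp f (fun z : C_R_NormedModule => fst z)
      (fun y : R => scal y l : C_R_NormedModule)
      (fun z : C_R_NormedModule => fst z) Hl _).
    apply filterdiff_linear, (is_linear_fst (U := R_NormedModule) (V := R_NormedModule)). }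
  assert (H2 : is_derive (fun t => Im (f t)) x (snd l)).
  { refine (filterdiff_comp f (fun z : C_R_NormedModule => snd z)
      (fun y : R => scal y l : C_R_NormedModule)
      (fun z : C_R_NormedModule => snd z) Hl _).
    apply filterdiff_linear, (is_linear_snd (U := R_NormedModule) (V := R_NormedModule)). }
  unfold RCDerive.
  apply is_derive_unique in H1, H2.
  replace (_, _) with l; [exact Hl |].
  destruct l as [a b]; exact (f_equal2 pair (eq_sym H1) (eq_sym H2)).
Qed.

Fixpoint RCDerive_n (f : R -> C) (n : nat) (x : R) : C :=
  match n with
  | O => f x
  | S n => RCDerive (RCDerive_n f n) x
  end.

(* d^(m1+m2) k / dv^m2 du^m1 at (u, v): first m1 times in the first variable,
   then m2 times in the second one. *)
Definition partial (m1 m2 : nat) (k : R -> R -> C) (u v : R) : C :=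
  RCDerive_n (fun y => RCDerive_n (fun x => k x y) m1 u) m2 v.

(* Every derivative taken on the way is required to exist at every point of U;
   as U is open, [partial m1 m2 k] is then the genuine derivative on U. *)
Definition ex_partial (m1 m2 : nat) (k : R -> R -> C) (U : R * R -> Prop) : Prop :=
  (forall j, (j < m1)%nat -> forall u v, U (u, v) ->
     ex_derive (V := C_R_NormedModule) (fun x => partial j 0 k x v) u) /\
  (forall j, (j < m2)%nat -> forall u v, U (u, v) ->
     ex_derive (V := C_R_NormedModule) (fun y => partial m1 j k u y) v).

(* Meant for open U, where continuity on U is continuity at each point of U. *)
Definition class_S (n : nat) (U : R * R -> Prop) (k : R -> R -> C) : Prop :=
  forall m1 m2 : nat, (m1 <= n)%nat -> (m2 <= n)%nat ->
    ex_partial m1 m2 k U /\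
    (forall p, U p ->
       continuous (fun q : R * R => partial m1 m2 k (fst q) (snd q)) p).

(* Main.v *)
Require Import Defs.
From Stdlib Require Import Reals Lra Lia List.
From Coquelicot Require Import Coquelicot.
Import ListNotations.

(** A positive definite kernel is a Gram matrix, k(x, y) = <phi x, phi y> for a
    map phi into a Hilbert space, and the smoothness of k near the diagonal is
    what is needed to differentiate phi n times in norm; the Gram matrix of the
    derivatives of phi then gives all the partial derivatives of k, on the
    whole square. Indeed the squared norm of the difference of two difference
    quotients of phi at x is a combination of mixed second differences of k
    close to (x, x); these all tend to the same value, d^2 k/dv du (x, x), and
    the combination tends to 0. So the quotients form a Cauchy family, and by
    the Cauchy-Schwarz inequality so do their products with any other vector.

    The proof below does this without constructing the Hilbert space. The
    vectors phi^(i) x are replaced by formal points (i, e, x), the jets, and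
    their inner products by the partial derivatives of the kernel. The induction
    on m proves that for orders up to m these partial derivatives exist, are
    continuous on the whole square, and again form a symmetric positive kernel.
    For the step:
    - near the diagonal, the mixed second differences of the partial derivative
      of order (m, m) have a limit by the mean value theorem
      ([mixed_difference_asymptotic], [class_diagonal_asymptotic]);
    - Cauchy-Schwarz carries this to difference quotients of the kernel at
      arbitrary pairs of jets ([kernel_cauchy_quotients],
      [kernel_derivative_cauchy_quotients]), locally uniformly, so that the new
      derivatives exist and are continuous
      ([cauchy_quotients_ex_derive], [cauchy_quotients_continuity]);
    - the derivatives may be taken in either order ([is_derive_mixed_swap]),
      which identifies them with the iterated partial derivatives of k;
    - jets of order m + 1 are limits of differences of jets of order m, so
      positivity persists ([positivity_limit], [jets_positive_succ]).

    Complex kernels are reduced to real ones by regarding the complex Hilbert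
    space as a real one: the vectors phi x and i phi x have real inner products
    given by the real and imaginary parts of k ([realified_positive]). The index
    e of a jet tells these two vectors apart. *)

(** * Mixed differences and mixed partial derivatives *)

Definition mixed_difference (f : R -> R -> R) (x y h h' : R) : R :=
  f (x + h) (y + h') - f (x + h) y - f x (y + h') + f x y.

Lemma increment_mean_value (f df : R -> R) (x h : R) :
  (forall u, Rabs (u - x) <= Rabs h -> is_derive f u (df u)) ->
  exists c, Rabs (c - x) <= Rabs h /\ f (x + h) - f x = df c * h.
Proof.
  intros Hd.
  assert (Hin : forall u, Rmin x (x + h) <= u <= Rmax x (x + h) ->
                  Rabs (u - x) <= Rabs h).
  { intros u; unfold Rmin, Rmax, Rabs.
    destruct (Rle_dec x (x + h)), (Rcase_abs (u - x)), (Rcase_abs h); lra. }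
  destruct (MVT_gen f x (x + h) df) as [c [Hc He]].
  - intros u Hu; apply Hd, Hin; lra.
  - intros u Hu; apply continuity_pt_filterlim.
    apply (ex_derive_continuous f u); exists (df u); auto.
  - exists c; split; [now apply Hin |].
    rewrite He; ring.
Qed.

(** The mixed difference is the increment in the first variable of the increment
    in the second one, so the mean value theorem applies twice. Only the mixed
    derivative taken in this order is involved. *)
Lemma mixed_difference_mean_value (f fu fvu : R -> R -> R) (x y h h' : R) :
  (forall u v, Rabs (u - x) <= Rabs h -> Rabs (v - y) <= Rabs h' ->
     is_derive (fun t => f t v) u (fu u v) /\ is_derive (fu u) v (fvu u v)) ->
  exists u v, Rabs (u - x) <= Rabs h /\ Rabs (v - y) <= Rabs h' /\
    mixed_difference f x y h h' = fvu u v * (h * h').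
Proof.
  intros Hd.
  destruct (increment_mean_value (fun t => f t (y + h') - f t y)
              (fun t => fu t (y + h') - fu t y) x h) as [u [Hu Eu]].
  { intros u Hu.
    apply (is_derive_minus (fun t => f t (y + h')) (fun t => f t y)); apply Hd; auto.
    - replace (y + h' - y) with h' by ring; lra.
    - replace (y - y) with 0 by ring; rewrite Rabs_R0; apply Rabs_pos. }
  destruct (increment_mean_value (fu u) (fvu u) y h') as [v [Hv Ev]].
  { intros v Hv; apply Hd; auto. }
  exists u, v; repeat split; auto.
  unfold mixed_difference.
  transitivity ((fu u (y + h') - fu u y) * h); [rewrite <- Eu; ring |].
  rewrite Ev; ring.
Qed.

(** The base point (x, y) of the differences varies with h and h': this uniformity
    makes the later convergences locally uniform. Bounding by a multiple of
    |h| |h'| instead of dividing by h h' spares the cases h = 0 and h' = 0. *)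
Lemma mixed_difference_asymptotic (f fu fvu : R -> R -> R) (x0 y0 : R) :
  locally_2d (fun u v => is_derive (fun t => f t v) u (fu u v)) x0 y0 ->
  locally_2d (fun u v => is_derive (fu u) v (fvu u v)) x0 y0 ->
  continuity_2d_pt fvu x0 y0 ->
  forall eps, 0 < eps -> exists delta, 0 < delta /\
    forall x y h h', Rabs (x - x0) < delta -> Rabs (y - y0) < delta ->
      Rabs h < delta -> Rabs h' < delta ->
      Rabs (mixed_difference f x y h h' - fvu x0 y0 * (h * h'))
        <= eps * (Rabs h * Rabs h').
Proof.
  intros [d1 H1] [d2 H2] Hc eps Heps.
  destruct (Hc (mkposreal eps Heps)) as [d3 H3]; simpl in H3.
  set (d := Rmin d1 (Rmin d2 d3)).
  assert (Hd : 0 < d /\ d <= d1 /\ d <= d2 /\ d <= d3).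
  { pose proof (cond_pos d1); pose proof (cond_pos d2); pose proof (cond_pos d3).
    unfold d; repeat split.
    - repeat apply Rmin_pos; auto.
    - apply Rmin_l.
    - eapply Rle_trans; [apply Rmin_r | apply Rmin_l].
    - eapply Rle_trans; [apply Rmin_r | apply Rmin_r]. }
  exists (d / 2); split; [lra |].
  intros x y h h' Hx Hy Hh Hh'.
  assert (Hnear : forall a b c e, Rabs (a - b) < d / 2 -> Rabs e < d / 2 ->
            Rabs (c - a) <= Rabs e -> Rabs (c - b) < d).
  { intros a b c e Ha He Hce; replace (c - b) with ((c - a) + (a - b)) by ring.
    pose proof (Rabs_triang (c - a) (a - b)); lra. }
  destruct (mixed_difference_mean_value f fu fvu x y h h') as [u [v [Hu [Hv E]]]].
  { intros u v Hu Hv.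
    pose proof (Hnear _ _ _ _ Hx Hh Hu); pose proof (Hnear _ _ _ _ Hy Hh' Hv).
    split; [apply H1 | apply H2]; lra. }
  rewrite E.
  replace (fvu u v * (h * h') - fvu x0 y0 * (h * h'))
    with ((fvu u v - fvu x0 y0) * (h * h')) by ring.
  rewrite !Rabs_mult.
  apply Rmult_le_compat_r; [apply Rmult_le_pos; apply Rabs_pos |].
  apply Rlt_le, H3.
  - pose proof (Hnear _ _ _ _ Hx Hh Hu); lra.
  - pose proof (Hnear _ _ _ _ Hy Hh' Hv); lra.
Qed.

(** The way in which bounds on increments pass to the limit, once one of several
    increments tends to zero. *)
Lemma is_derive_close (g : R -> R) (y a b M d : R) :
  is_derive g y a -> 0 < d ->
  (forall h, Rabs h < d -> Rabs (g (y + h) - g y - b * h) <= M * Rabs h) ->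
  Rabs (a - b) <= M.
Proof.
  intros Hg Hd Hb.
  apply le_epsilon; intros eps Heps.
  apply is_derive_Reals in Hg.
  destruct (Hg eps Heps) as [r Hr].
  pose proof (cond_pos r) as Hrp.
  set (h := Rmin d r / 2).
  assert (Hh : 0 < h /\ h < d /\ h < r).
  { pose proof (Rmin_l d r); pose proof (Rmin_r d r).
    pose proof (Rmin_pos d r Hd Hrp); unfold h; lra. }
  assert (Ha : Rabs h = h) by (apply Rabs_pos_eq; lra).
  specialize (Hr h ltac:(lra) ltac:(lra)).
  specialize (Hb h ltac:(lra)); rewrite Ha in Hb.
  set (q := (g (y + h) - g y) / h) in *.
  assert (Hq : Rabs (q - b) <= M).
  { apply (Rmult_le_reg_r h); [lra |].
    rewrite <- Ha at 1; rewrite <- Rabs_mult.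
    replace ((q - b) * h) with (g (y + h) - g y - b * h); [exact Hb |].
    unfold q; field; lra. }
  replace (a - b) with (- (q - a) + (q - b)) by ring.
  pose proof (Rabs_triang (- (q - a)) (q - b)) as Ht.
  rewrite Rabs_Ropp in Ht; lra.
Qed.

Lemma is_derive_of_asymptotic (g : R -> R) (x l : R) :
  (forall eps, 0 < eps -> exists d, 0 < d /\
     forall h, Rabs h < d -> Rabs (g (x + h) - g x - l * h) <= eps * Rabs h) ->
  is_derive g x l.
Proof.
  intros H; apply is_derive_Reals; intros eps Heps.
  destruct (H (eps / 2) ltac:(lra)) as [d [Hd Hb]].
  exists (mkposreal d Hd); intros h Hh0 Hh; simpl in Hh.
  specialize (Hb h Hh).
  pose proof (Rabs_pos_lt h Hh0) as Hp.
  apply Rle_lt_trans with (eps / 2); [| lra].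
  apply (Rmult_le_reg_r (Rabs h)); [lra |].
  rewrite <- Rabs_mult.
  replace (((g (x + h) - g x) / h - l) * h) with (g (x + h) - g x - l * h);
    [exact Hb | field; auto].
Qed.

(** Peano's form of the theorem on the symmetry of mixed derivatives: the derivative
    in the opposite order is not supposed to exist. It does because the mixed
    difference, divided by h', tends to the increment of fv as h' tends to 0,
    while it stays within eps |h| of h times the known mixed derivative. *)
Lemma is_derive_mixed_swap (f fu fv fvu : R -> R -> R) (x0 y0 : R) :
  locally_2d (fun u v => is_derive (fun t => f t v) u (fu u v)) x0 y0 ->
  locally_2d (fun u v => is_derive (fu u) v (fvu u v)) x0 y0 ->
  continuity_2d_pt fvu x0 y0 ->
  locally x0 (fun u => is_derive (f u) y0 (fv u y0)) ->
  is_derive (fun t => fv t y0) x0 (fvu x0 y0).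
Proof.
  intros H1 H2 Hc [r Hv].
  apply is_derive_of_asymptotic; intros eps Heps.
  destruct (mixed_difference_asymptotic f fu fvu x0 y0 H1 H2 Hc eps Heps)
    as [d [Hd Hb]].
  pose proof (cond_pos r) as Hr.
  exists (Rmin d r); split; [now apply Rmin_pos |].
  intros h Hh.
  pose proof (Rmin_l d r); pose proof (Rmin_r d r).
  assert (Hx : is_derive (fun t => f (x0 + h) t - f x0 t) y0
                 (fv (x0 + h) y0 - fv x0 y0)).
  { apply (is_derive_minus (f (x0 + h)) (f x0)); apply Hv.
    - change (Rabs (x0 + h - x0) < r); replace (x0 + h - x0) with h by ring; lra.
    - apply ball_center. }
  apply (is_derive_close _ _ _ _ _ d Hx Hd).
  intros h' Hh'.
  specialize (Hb x0 y0 h h').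
  unfold Rminus at 1 2 in Hb; rewrite !Rplus_opp_r, Rabs_R0 in Hb.
  specialize (Hb Hd Hd ltac:(lra) Hh').
  replace (_ - _ - _) with (mixed_difference f x0 y0 h h' - fvu x0 y0 * (h * h'))
    by (unfold mixed_difference; ring).
  rewrite (Rmult_assoc eps); exact Hb.
Qed.

(** * Locally uniformly Cauchy difference quotients *)

(** The difference quotients in the first variable satisfy the Cauchy criterion
    uniformly near (x0, y0); the condition is multiplied out by h1 h2. *)
Definition cauchy_quotients (f : R -> R -> R) (x0 y0 : R) : Prop :=
  forall eps, 0 < eps -> exists d, 0 < d /\
    forall x y h1 h2, Rabs (x - x0) < d -> Rabs (y - y0) < d ->
      Rabs h1 < d -> Rabs h2 < d ->
      Rabs ((f (x + h1) y - f x y) * h2 - (f (x + h2) y - f x y) * h1)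
        <= eps * (Rabs h1 * Rabs h2).

Lemma cauchy_quotients_ex_derive (f : R -> R -> R) (x0 y0 : R) :
  cauchy_quotients f x0 y0 -> ex_derive (fun x => f x y0) x0.
Proof.
  intros H.
  set (h := fun n => / INR (S n)).
  assert (Hh : forall n, 0 < h n) by (intros n; apply Rinv_0_lt_compat, lt_0_INR; lia).
  assert (Hsmall : forall d, 0 < d -> exists N, forall n, (N <= n)%nat -> h n < d).
  { intros d Hd; destruct (archimed_cor1 d Hd) as [N [HN HN0]].
    exists N; intros n Hn; apply Rle_lt_trans with (/ INR N); auto.
    apply Rinv_le_contravar; [now apply lt_0_INR | apply le_INR; lia]. }
  set (q := fun n => (f (x0 + h n) y0 - f x0 y0) / h n).
  assert (Hq : forall n, f (x0 + h n) y0 - f x0 y0 = q n * h n).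
  { intros n; unfold q; field; specialize (Hh n); lra. }
  assert (Hself : forall z d, 0 < d -> Rabs (z - z) < d).
  { intros z d Hd; unfold Rminus; rewrite Rplus_opp_r, Rabs_R0; exact Hd. }
  destruct (Rcomplete.R_complete q) as [l Hl].
  { intros eps Heps.
    destruct (H (eps / 2) ltac:(lra)) as [d [Hd Hb]].
    destruct (Hsmall d Hd) as [N HN]; exists N; intros n m Hn Hm.
    pose proof (Hh n) as Pn; pose proof (Hh m) as Pm.
    pose proof (Rmult_lt_0_compat _ _ Pn Pm) as Pnm.
    specialize (Hb x0 y0 (h n) (h m) (Hself _ _ Hd) (Hself _ _ Hd)).
    rewrite !(Rabs_pos_eq (h _)) in Hb by lra.
    specialize (Hb (HN n Hn) (HN m Hm)).
    rewrite !Hq in Hb.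
    replace (q n * h n * h m - q m * h m * h n) with ((q n - q m) * (h n * h m))
      in Hb by ring.
    rewrite Rabs_mult, (Rabs_pos_eq (h n * h m)) in Hb by lra.
    apply Rmult_le_reg_r in Hb; [| exact Pnm].
    unfold Rdist; lra. }
  exists l; apply is_derive_of_asymptotic; intros eps Heps.
  destruct (H (eps / 2) ltac:(lra)) as [d [Hd Hb]].
  exists d; split; auto; intros t Ht.
  destruct (Hsmall d Hd) as [N HN].
  destruct (Hl (eps / 2) ltac:(lra)) as [N' HN'].
  set (n := max N N').
  specialize (HN' n ltac:(unfold n; lia)); unfold Rdist in HN'.
  specialize (HN n ltac:(unfold n; lia)).
  pose proof (Hh n) as Pn.
  specialize (Hb x0 y0 t (h n) (Hself _ _ Hd) (Hself _ _ Hd) Ht).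
  rewrite (Rabs_pos_eq (h n)) in Hb by lra.
  specialize (Hb HN); rewrite Hq in Hb.
  set (D := f (x0 + t) y0 - f x0 y0) in *.
  replace (D * h n - q n * h n * t) with ((D - q n * t) * h n) in Hb by ring.
  rewrite Rabs_mult, (Rabs_pos_eq (h n)), <- Rmult_assoc in Hb by lra.
  apply Rmult_le_reg_r in Hb; [| exact Pn].
  replace (D - l * t) with ((D - q n * t) + (q n - l) * t) by ring.
  pose proof (Rabs_triang (D - q n * t) ((q n - l) * t)) as Htr.
  rewrite Rabs_mult in Htr.
  pose proof (Rabs_pos t) as Pt.
  pose proof (Rmult_le_compat_r _ _ _ Pt (Rlt_le _ _ HN')); lra.
Qed.

(** A locally uniform limit of continuous functions is continuous: near (x0, y0)
    the derivative is within eps of one fixed difference quotient, which is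
    continuous because f is. *)
Lemma cauchy_quotients_continuity (f : R -> R -> R) (x0 y0 : R) :
  cauchy_quotients f x0 y0 ->
  locally_2d (fun u v => ex_derive (fun x => f x v) u) x0 y0 ->
  locally_2d (continuity_2d_pt f) x0 y0 ->
  continuity_2d_pt (fun u v => Derive (fun x => f x v) u) x0 y0.
Proof.
  intros H [d1 Hex] [d2 Hc] eps.
  pose proof (cond_pos eps) as He.
  destruct (H (eps / 4) ltac:(lra)) as [d [Hd Hb]].
  pose proof (cond_pos d1) as P1; pose proof (cond_pos d2) as P2.
  set (h := Rmin d d2 / 2).
  assert (Hh : 0 < h /\ h < d /\ h < d2).
  { pose proof (Rmin_l d d2); pose proof (Rmin_r d d2).
    pose proof (Rmin_pos d d2 Hd P2); unfold h; lra. }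
  assert (Hself : forall z r, 0 < r -> Rabs (z - z) < r).
  { intros z r Hr; unfold Rminus; rewrite Rplus_opp_r, Rabs_R0; exact Hr. }
  assert (Hquot : forall u v, Rabs (u - x0) < Rmin d d1 -> Rabs (v - y0) < Rmin d d1 ->
     Rabs (Derive (fun x => f x v) u * h - (f (u + h) v - f u v)) <= eps / 4 * h).
  { intros u v Hu Hv.
    pose proof (Rmin_l d d1); pose proof (Rmin_r d d1).
    assert (Hder : is_derive (fun x => f x v * h) u (Derive (fun x => f x v) u * h)).
    { apply is_derive_Reals, derivable_pt_lim_scal_right, is_derive_Reals.
      apply Derive_correct, Hex; lra. }
    apply (is_derive_close _ _ _ _ _ d Hder Hd).
    intros t Ht.
    specialize (Hb u v t h ltac:(lra) ltac:(lra) Ht).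
    rewrite (Rabs_pos_eq h) in Hb by lra.
    replace (f (u + t) v * h - f u v * h - (f (u + h) v - f u v) * t)
      with ((f (u + t) v - f u v) * h - (f (u + h) v - f u v) * t) by ring.
    eapply Rle_trans; [apply Hb; lra | right; ring]. }
  assert (Hch : continuity_2d_pt f (x0 + h) y0).
  { apply Hc; [replace (x0 + h - x0) with h by ring; rewrite Rabs_pos_eq; lra
              | now apply Hself]. }
  assert (Hc0 : continuity_2d_pt f x0 y0) by (apply Hc; now apply Hself).
  assert (Pe : 0 < eps / 8 * h) by (apply Rmult_lt_0_compat; lra).
  destruct (Hch (mkposreal _ Pe)) as [r1 Hr1].
  destruct (Hc0 (mkposreal _ Pe)) as [r2 Hr2].
  simpl in Hr1, Hr2.
  pose proof (cond_pos r1) as Q1; pose proof (cond_pos r2) as Q2.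
  assert (Pr : 0 < Rmin (Rmin d d1) (Rmin r1 r2)) by (repeat apply Rmin_pos; auto).
  exists (mkposreal _ Pr); simpl; intros u v Hu Hv.
  pose proof (Rmin_l (Rmin d d1) (Rmin r1 r2)).
  pose proof (Rmin_r (Rmin d d1) (Rmin r1 r2)).
  pose proof (Rmin_l r1 r2); pose proof (Rmin_r r1 r2).
  pose proof (Hquot u v ltac:(lra) ltac:(lra)) as K1.
  pose proof (Hquot x0 y0 (Hself x0 (Rmin d d1) ltac:(lra))
    (Hself y0 (Rmin d d1) ltac:(lra))) as K2.
  specialize (Hr1 (u + h) v).
  replace (u + h - (x0 + h)) with (u - x0) in Hr1 by ring.
  specialize (Hr1 ltac:(lra) ltac:(lra)).
  specialize (Hr2 u v ltac:(lra) ltac:(lra)).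
  set (D := Derive (fun x => f x v) u) in *.
  set (D0 := Derive (fun x => f x y0) x0) in *.
  apply (Rmult_lt_reg_r h); [lra |].
  rewrite <- (Rabs_pos_eq h) at 1 by lra; rewrite <- Rabs_mult.
  replace ((D - D0) * h) with
    ((D * h - (f (u + h) v - f u v)) + (- (D0 * h - (f (x0 + h) y0 - f x0 y0)) +
      ((f (u + h) v - f (x0 + h) y0) + - (f u v - f x0 y0)))) by ring.
  eapply Rle_lt_trans; [apply Rabs_triang |].
  eapply Rle_lt_trans; [apply Rplus_le_compat_l, Rabs_triang |].
  eapply Rle_lt_trans; [apply Rplus_le_compat_l, Rplus_le_compat_l, Rabs_triang |].
  rewrite !Rabs_Ropp.
  assert (0 < eps * h) by (apply Rmult_lt_0_compat; lra).
  lra.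
Qed.

(** * Positive kernels and the Cauchy-Schwarz inequality *)

Definition sum_over {A : Type} (f : A -> R) (l : list A) : R :=
  fold_right (fun a s => f a + s) 0 l.

Lemma sum_over_ext {A : Type} (f g : A -> R) (l : list A) :
  (forall a, In a l -> f a = g a) -> sum_over f l = sum_over g l.
Proof.
  induction l as [|a l IH]; intros H; simpl; auto.
  rewrite (H a) by (simpl; auto); rewrite IH; auto.
  intros b Hb; apply H; simpl; auto.
Qed.

Lemma sum_over_app {A : Type} (f : A -> R) (l l' : list A) :
  sum_over f (l ++ l') = sum_over f l + sum_over f l'.
Proof. induction l as [|a l IH]; simpl; [ring | rewrite IH; ring]. Qed.

Lemma sum_over_map {A B : Type} (f : B -> R) (g : A -> B) (l : list A) :
  sum_over f (map g l) = sum_over (fun a => f (g a)) l.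
Proof. induction l as [|a l IH]; simpl; [auto | now rewrite IH]. Qed.

Lemma sum_over_plus {A : Type} (f g : A -> R) (l : list A) :
  sum_over (fun a => f a + g a) l = sum_over f l + sum_over g l.
Proof. induction l as [|a l IH]; simpl; [ring | rewrite IH; ring]. Qed.

Lemma sum_over_scal {A : Type} (c : R) (f : A -> R) (l : list A) :
  sum_over (fun a => c * f a) l = c * sum_over f l.
Proof. induction l as [|a l IH]; simpl; [ring | rewrite IH; ring]. Qed.

Lemma sum_over_zero {A : Type} (l : list A) : sum_over (fun _ => 0) l = 0.
Proof. induction l as [|a l IH]; simpl; [ring | rewrite IH; ring]. Qed.

Lemma sum_over_exchange {A B : Type} (f : A -> B -> R) (l : list A) (l' : list B) :
  sum_over (fun a => sum_over (f a) l') l =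
  sum_over (fun b => sum_over (fun a => f a b) l) l'.
Proof.
  induction l as [|a l IH]; simpl.
  - now rewrite sum_over_zero.
  - now rewrite IH, sum_over_plus.
Qed.

(** With K the Gram matrix of a family of vectors, this is the inner product of two
    finite linear combinations given by their lists of weighted points. *)
Definition form {T : Type} (K : T -> T -> R) (l l' : list (R * T)) : R :=
  sum_over (fun a => sum_over (fun b => fst a * fst b * K (snd a) (snd b)) l') l.

Definition supported {T : Type} (D : T -> Prop) (l : list (R * T)) : Prop :=
  forall a, In a l -> D (snd a).

Record positive_on {T : Type} (D : T -> Prop) (K : T -> T -> R) : Prop := {
  kernel_sym : forall p q, D p -> D q -> K p q = K q p;
  form_nonneg : forall l, supported D l -> 0 <= form K l l }.

Lemma form_app_l {T : Type} (K : T -> T -> R) (l1 l2 l' : list (R * T)) :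
  form K (l1 ++ l2) l' = form K l1 l' + form K l2 l'.
Proof. apply sum_over_app. Qed.

Lemma form_app_r {T : Type} (K : T -> T -> R) (l l1 l2 : list (R * T)) :
  form K l (l1 ++ l2) = form K l l1 + form K l l2.
Proof.
  unfold form; rewrite <- sum_over_plus.
  apply sum_over_ext; intros a _; apply sum_over_app.
Qed.

Definition scale {T : Type} (c : R) (l : list (R * T)) : list (R * T) :=
  map (fun a => (c * fst a, snd a)) l.

Lemma supported_scale {T : Type} (D : T -> Prop) (c : R) (l : list (R * T)) :
  supported D l -> supported D (scale c l).
Proof.
  intros H a Ha; apply in_map_iff in Ha; destruct Ha as [b [<- Hb]]; exact (H b Hb).
Qed.

Lemma supported_app {T : Type} (D : T -> Prop) (l l' : list (R * T)) :
  supported D l -> supported D l' -> supported D (l ++ l').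
Proof. intros H H' a Ha; apply in_app_or in Ha; destruct Ha; auto. Qed.

Lemma form_scale_l {T : Type} (K : T -> T -> R) (c : R) (l l' : list (R * T)) :
  form K (scale c l) l' = c * form K l l'.
Proof.
  unfold form, scale; rewrite sum_over_map, <- sum_over_scal.
  apply sum_over_ext; intros a _; rewrite <- sum_over_scal.
  apply sum_over_ext; intros b _; simpl; ring.
Qed.

Lemma form_scale_r {T : Type} (K : T -> T -> R) (c : R) (l l' : list (R * T)) :
  form K l (scale c l') = c * form K l l'.
Proof.
  unfold form, scale; rewrite <- sum_over_scal.
  apply sum_over_ext; intros a _; rewrite sum_over_map, <- sum_over_scal.
  apply sum_over_ext; intros b _; simpl; ring.
Qed.

Lemma form_sym {T : Type} (D : T -> Prop) (K : T -> T -> R) (l l' : list (R * T)) :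
  positive_on D K -> supported D l -> supported D l' -> form K l l' = form K l' l.
Proof.
  intros HK Hl Hl'; unfold form.
  rewrite (sum_over_exchange
    (fun a b => fst a * fst b * K (snd a) (snd b)) l l').
  apply sum_over_ext; intros b Hb; apply sum_over_ext; intros a Ha.
  rewrite (kernel_sym _ _ HK (snd a)); auto; ring.
Qed.

Lemma cauchy_schwarz {T : Type} (D : T -> Prop) (K : T -> T -> R)
    (l l' : list (R * T)) :
  positive_on D K -> supported D l -> supported D l' ->
  form K l l' * form K l l' <= form K l l * form K l' l'.
Proof.
  intros HK Hl Hl'.
  assert (Hq : forall s t, 0 <= s * s * form K l l + 2 * s * t * form K l l'
                               + t * t * form K l' l').
  { intros s t.
    pose proof (form_nonneg _ _ HK (scale s l ++ scale t l')
      (supported_app _ _ _ (supported_scale _ s _ Hl) (supported_scale _ t _ Hl')))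
      as H.
    rewrite form_app_l, !form_app_r, !form_scale_l, !form_scale_r in H.
    rewrite (form_sym D K l' l) in H by auto.
    lra. }
  set (a := form K l l) in *; set (b := form K l l') in *.
  set (c := form K l' l') in *.
  assert (Hc : 0 <= c) by (pose proof (Hq 0 1); lra).
  destruct (Rle_lt_or_eq_dec 0 c Hc) as [Hp | H0].
  - pose proof (Hq c (- b)) as H.
    apply (Rmult_le_reg_l c); [exact Hp | lra].
  - (* As c = 0, the value of the form at s = b, t = - (a + 1) / 2 is - b^2. *)
    pose proof (Hq b (- (a + 1) / 2)) as H; rewrite <- H0 in H |- *; lra.
Qed.

Lemma sqr_le_Rabs (a b : R) : 0 <= b -> a * a <= b * b -> Rabs a <= b.
Proof.
  intros Hb H; rewrite <- (Rabs_pos_eq b Hb).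
  now apply Rsqr_le_abs_0.
Qed.

(** * Curves in a kernel with smooth diagonal *)

(** For g the Gram matrix of a curve phi, this says that the inner products of any
    two difference quotients of phi near x0 converge to c, hence that phi is
    differentiable at x0 with |phi'(x0)|^2 = c. *)
Definition diagonal_asymptotic (g : R -> R -> R) (x0 c : R) : Prop :=
  forall eps, 0 < eps -> exists d, 0 < d /\
    forall x h h', Rabs (x - x0) < d -> Rabs h < d -> Rabs h' < d ->
      Rabs (mixed_difference g x x h h' - c * (h * h')) <= eps * (Rabs h * Rabs h').

(** The difference of the quotients of steps h1 and h2 along the curve gamma,
    multiplied by h1 h2. *)
Definition quotient_difference {T : Type} (gamma : R -> T) (x h1 h2 : R)
  : list (R * T) :=
  [(h2, gamma (x + h1)); (- h2, gamma x); (- h1, gamma (x + h2)); (h1, gamma x)].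

(** All four mixed differences are close to c times the product of their steps, and
    the multiples of c cancel. *)
Lemma quotient_difference_norm {T : Type} (K : T -> T -> R) (gamma : R -> T) (x0 c : R) :
  diagonal_asymptotic (fun u v => K (gamma u) (gamma v)) x0 c ->
  forall eps, 0 < eps -> exists d, 0 < d /\
    forall x h1 h2, Rabs (x - x0) < d -> Rabs h1 < d -> Rabs h2 < d ->
      form K (quotient_difference gamma x h1 h2) (quotient_difference gamma x h1 h2)
        <= eps * ((Rabs h1 * Rabs h2) * (Rabs h1 * Rabs h2)).
Proof.
  intros H eps Heps.
  destruct (H (eps / 4) ltac:(lra)) as [d [Hd Hb]].
  exists d; split; auto; intros x h1 h2 Hx H1 H2.
  set (e := fun h h' => mixed_difference (fun u v => K (gamma u) (gamma v)) x x h h'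
                          - c * (h * h')).
  transitivity (h2 * h2 * e h1 h1 + (- (h1 * h2) * e h1 h2) + (- (h1 * h2) * e h2 h1)
                + h1 * h1 * e h2 h2).
  { right; unfold e, form, quotient_difference, mixed_difference; simpl; ring. }
  assert (He : forall a b h h', Rabs h < d -> Rabs h' < d ->
     Rabs (a * b) * (Rabs h * Rabs h') = (Rabs h1 * Rabs h2) * (Rabs h1 * Rabs h2) ->
     a * b * e h h' <= eps / 4 * ((Rabs h1 * Rabs h2) * (Rabs h1 * Rabs h2))).
  { intros a b h h' Hh Hh' E.
    eapply Rle_trans; [apply Rle_abs |].
    rewrite Rabs_mult, <- E.
    replace (eps / 4 * (Rabs (a * b) * (Rabs h * Rabs h')))
      with (Rabs (a * b) * (eps / 4 * (Rabs h * Rabs h'))) by ring.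
    apply Rmult_le_compat_l; [apply Rabs_pos | now apply Hb]. }
  pose proof (He h2 h2 h1 h1 H1 H1 ltac:(rewrite Rabs_mult; ring)).
  pose proof (He h1 h1 h2 h2 H2 H2 ltac:(rewrite Rabs_mult; ring)).
  pose proof (He (- h1) h2 h1 h2 H1 H2 ltac:(rewrite Rabs_mult, Rabs_Ropp; ring)).
  pose proof (He (- h1) h2 h2 h1 H2 H1 ltac:(rewrite Rabs_mult, Rabs_Ropp; ring)).
  lra.
Qed.

(** Cauchy-Schwarz: the bound involves no relation between the curve and l', in
    particular l' may live at points far from x0. The number t is a free scale
    for the norm of l'. *)
Lemma quotient_difference_small {T : Type} (D : T -> Prop) (K : T -> T -> R)
    (gamma : R -> T) (x0 c M : R) :
  positive_on D K -> locally x0 (fun x => D (gamma x)) ->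
  diagonal_asymptotic (fun u v => K (gamma u) (gamma v)) x0 c -> 0 < M ->
  forall eps, 0 < eps -> exists d, 0 < d /\
    forall x h1 h2 t l', Rabs (x - x0) < d -> Rabs h1 < d -> Rabs h2 < d ->
      supported D l' -> 0 <= t -> form K l' l' <= M * (t * t) ->
      Rabs (form K (quotient_difference gamma x h1 h2) l')
        <= eps * (Rabs h1 * Rabs h2) * t.
Proof.
  intros HK [r Hr] Hg HM eps Heps.
  assert (Pe : 0 < eps * eps / M) by (apply Rdiv_lt_0_compat; [nra | auto]).
  destruct (quotient_difference_norm K gamma x0 c Hg _ Pe) as [d [Hd Hb]].
  pose proof (cond_pos r) as Pr.
  assert (Hm : 0 < Rmin d (r / 2)) by (apply Rmin_pos; lra).
  exists (Rmin d (r / 2)); split; auto.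
  intros x h1 h2 t l' Hx H1 H2 Hl' Ht Hn.
  pose proof (Rmin_l d (r / 2)); pose proof (Rmin_r d (r / 2)).
  assert (HD : forall h, Rabs h < r / 2 -> D (gamma (x + h))).
  { intros h Hh; apply Hr; change (Rabs (x + h - x0) < r).
    replace (x + h - x0) with ((x - x0) + h) by ring.
    pose proof (Rabs_triang (x - x0) h); lra. }
  assert (HD0 : D (gamma x)).
  { rewrite <- (Rplus_0_r x); apply HD; rewrite Rabs_R0; lra. }
  assert (Hs : supported D (quotient_difference gamma x h1 h2)).
  { intros a; simpl; intros [<- | [<- | [<- | [<- | []]]]]; simpl; auto;
      apply HD; lra. }
  assert (P12 : 0 <= Rabs h1 * Rabs h2) by (apply Rmult_le_pos; apply Rabs_pos).
  apply sqr_le_Rabs.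
  { apply Rmult_le_pos; auto; apply Rmult_le_pos; auto; lra. }
  eapply Rle_trans; [apply (cauchy_schwarz D K); auto |].
  eapply Rle_trans.
  { apply Rmult_le_compat; [now apply (form_nonneg D) | now apply (form_nonneg D) | | exact Hn].
    apply Hb; lra. }
  right; field; lra.
Qed.

(** A smooth diagonal along gamma alone makes the kernel differentiable along gamma,
    against every point of the family; continuity along delta serves to bound its
    norm near y0. *)
Lemma kernel_cauchy_quotients {T : Type} (D : T -> Prop) (K : T -> T -> R)
    (gamma delta : R -> T) (x0 y0 c : R) :
  positive_on D K ->
  locally x0 (fun x => D (gamma x)) -> locally y0 (fun y => D (delta y)) ->
  diagonal_asymptotic (fun u v => K (gamma u) (gamma v)) x0 c ->
  continuity_2d_pt (fun u v => K (delta u) (delta v)) y0 y0 ->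
  cauchy_quotients (fun u v => K (gamma u) (delta v)) x0 y0.
Proof.
  intros HK Hx [r Hy] Hg Hc eps Heps.
  destruct (Hc (mkposreal 1 Rlt_0_1)) as [r' Hr']; simpl in Hr'.
  set (M := Rabs (K (delta y0) (delta y0)) + 1).
  assert (HM : 0 < M) by (unfold M; pose proof (Rabs_pos (K (delta y0) (delta y0))); lra).
  destruct (quotient_difference_small D K gamma x0 c M HK Hx Hg HM eps Heps)
    as [d [Hd Hb]].
  pose proof (cond_pos r); pose proof (cond_pos r').
  exists (Rmin d (Rmin r r')); split; [repeat apply Rmin_pos; auto |].
  intros x y h1 h2 Hx' Hy' H1 H2.
  pose proof (Rmin_l d (Rmin r r')); pose proof (Rmin_r d (Rmin r r')).
  pose proof (Rmin_l r r'); pose proof (Rmin_r r r').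
  specialize (Hb x h1 h2 1 [(1, delta y)] ltac:(lra) ltac:(lra) ltac:(lra)).
  replace (form K (quotient_difference gamma x h1 h2) [(1, delta y)])
    with ((K (gamma (x + h1)) (delta y) - K (gamma x) (delta y)) * h2 -
          (K (gamma (x + h2)) (delta y) - K (gamma x) (delta y)) * h1) in Hb
    by (unfold form, quotient_difference; simpl; ring).
  rewrite !Rmult_1_r in Hb; apply Hb; [| lra |].
  - intros a; simpl; intros [<- | []]; apply Hy; change (Rabs (y - y0) < r); lra.
  - specialize (Hr' y y ltac:(lra) ltac:(lra)).
    unfold form; simpl; unfold M.
    pose proof (Rabs_triang (K (delta y) (delta y) - K (delta y0) (delta y0))
                  (K (delta y0) (delta y0))) as Ht.
    replace (_ - _ + _) with (K (delta y) (delta y)) in Ht by ring.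
    pose proof (Rle_abs (K (delta y) (delta y))); lra.
Qed.

(** With a smooth diagonal along both curves, the derivative along gamma can be
    differentiated along delta. Its quotients along delta are limits of
    increments along gamma, and an increment of step h along gamma has norm
    at most a constant times |h|. *)
Lemma kernel_derivative_cauchy_quotients {T : Type} (D : T -> Prop) (K : T -> T -> R)
    (gamma delta : R -> T) (p : R -> R -> R) (x0 y0 c c' : R) :
  positive_on D K ->
  locally x0 (fun x => D (gamma x)) -> locally y0 (fun y => D (delta y)) ->
  diagonal_asymptotic (fun u v => K (gamma u) (gamma v)) x0 c ->
  diagonal_asymptotic (fun u v => K (delta u) (delta v)) y0 c' ->
  locally_2d (fun u v => is_derive (fun t => K (gamma t) (delta v)) u (p u v)) x0 y0 ->
  cauchy_quotients (fun v u => p u v) y0 x0.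
Proof.
  intros HK Hx Hy Hg Hg' [r Hp] eps Heps.
  set (M := Rabs c + 1).
  assert (HM : 0 < M) by (unfold M; pose proof (Rabs_pos c); lra).
  destruct (quotient_difference_small D K delta y0 c' M HK Hy Hg' HM eps Heps)
    as [d [Hd Hb]].
  destruct (Hg 1 Rlt_0_1) as [d' [Hd' Hb']].
  destruct Hx as [rx Hx].
  destruct Hy as [ry Hy].
  pose proof (cond_pos r) as Pr; pose proof (cond_pos rx) as Prx.
  pose proof (cond_pos ry) as Pry.
  set (s := Rmin (Rmin d d') (Rmin r (Rmin rx ry))).
  assert (Hs : 0 < s /\ s <= d /\ s <= d' /\ s <= r /\ s <= rx /\ s <= ry).
  { unfold s; pose proof (Rmin_l (Rmin d d') (Rmin r (Rmin rx ry)));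
      pose proof (Rmin_r (Rmin d d') (Rmin r (Rmin rx ry)));
      pose proof (Rmin_l d d'); pose proof (Rmin_r d d');
      pose proof (Rmin_l r (Rmin rx ry)); pose proof (Rmin_r r (Rmin rx ry));
      pose proof (Rmin_l rx ry); pose proof (Rmin_r rx ry).
    split; [repeat apply Rmin_pos; auto | lra]. }
  clearbody s.
  exists (s / 2); split; [lra |].
  intros y x h1 h2 Hy' Hx' H1 H2.
  assert (Hder : is_derive
     (fun t => (K (gamma t) (delta (y + h1)) - K (gamma t) (delta y)) * h2 -
               (K (gamma t) (delta (y + h2)) - K (gamma t) (delta y)) * h1) x
     ((p x (y + h1) - p x y) * h2 - (p x (y + h2) - p x y) * h1)).
  { assert (Hpt : forall h, Rabs h < s / 2 ->
      is_derive (fun t => K (gamma t) (delta (y + h))) x (p x (y + h))).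
    { intros h Hh; apply Hp; [lra |].
      replace (y + h - y0) with ((y - y0) + h) by ring.
      pose proof (Rabs_triang (y - y0) h); lra. }
    assert (Hpt0 : is_derive (fun t => K (gamma t) (delta y)) x (p x y))
      by (apply Hp; lra).
    apply (is_derive_minus (V := R_NormedModule)
      (fun t => (K (gamma t) (delta (y + h1)) - K (gamma t) (delta y)) * h2)).
    - apply is_derive_Reals, derivable_pt_lim_scal_right, is_derive_Reals.
      apply (is_derive_minus (V := R_NormedModule)
        (fun t => K (gamma t) (delta (y + h1)))); auto.
    - apply is_derive_Reals, derivable_pt_lim_scal_right, is_derive_Reals.
      apply (is_derive_minus (V := R_NormedModule)
        (fun t => K (gamma t) (delta (y + h2)))); auto. }
  rewrite <- (Rminus_0_r (_ - _)).
  apply (is_derive_close _ _ _ _ _ (s / 2) Hder); [lra |].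
  intros h Hh.
  assert (HDx : forall t, Rabs t < s / 2 -> D (gamma (x + t))).
  { intros t Ht; apply Hx; change (Rabs (x + t - x0) < rx).
    replace (x + t - x0) with ((x - x0) + t) by ring.
    pose proof (Rabs_triang (x - x0) t); lra. }
  assert (HDx0 : D (gamma x)).
  { rewrite <- (Rplus_0_r x); apply HDx; rewrite Rabs_R0; lra. }
  assert (HDy : forall t, Rabs t < s / 2 -> D (delta (y + t))).
  { intros t Ht; apply Hy; change (Rabs (y + t - y0) < ry).
    replace (y + t - y0) with ((y - y0) + t) by ring.
    pose proof (Rabs_triang (y - y0) t); lra. }
  assert (HDy0 : D (delta y)).
  { rewrite <- (Rplus_0_r y); apply HDy; rewrite Rabs_R0; lra. }
  set (l' := [(1, gamma (x + h)); (-1, gamma x)]).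
  assert (Hl' : supported D l').
  { intros a; simpl; intros [<- | [<- | []]]; simpl; auto; apply HDx; lra. }
  assert (Hl : supported D (quotient_difference delta y h1 h2)).
  { intros a; simpl; intros [<- | [<- | [<- | [<- | []]]]]; simpl; auto;
      apply HDy; lra. }
  specialize (Hb y h1 h2 (Rabs h) l' ltac:(lra) ltac:(lra) ltac:(lra) Hl'
                (Rabs_pos h)).
  rewrite (form_sym D K _ l' HK Hl Hl') in Hb.
  match goal with |- Rabs ?z <= _ =>
    replace z with (form K l' (quotient_difference delta y h1 h2))
      by (unfold l', form, quotient_difference; simpl; ring) end.
  apply Hb.
  specialize (Hb' x h h ltac:(lra) ltac:(lra) ltac:(lra)).
  replace (form K l' l')
    with (mixed_difference (fun u v => K (gamma u) (gamma v)) x x h h)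
    by (unfold l', form, mixed_difference; simpl; ring).
  set (E := mixed_difference _ _ _ _ _) in *.
  pose proof (Rle_abs (E - c * (h * h))).
  pose proof (Rle_abs (c * (h * h))) as Hc.
  rewrite !Rabs_mult in Hc; unfold M; lra.
Qed.

(** Continuity of the curves in norm at x0 and y0 follows from continuity of the
    kernel at the two diagonal points, and it implies continuity of the inner
    product at (x0, y0). *)
Lemma kernel_continuity {T : Type} (D : T -> Prop) (K : T -> T -> R)
    (gamma delta : R -> T) (x0 y0 : R) :
  positive_on D K ->
  locally x0 (fun x => D (gamma x)) -> locally y0 (fun y => D (delta y)) ->
  continuity_2d_pt (fun u v => K (gamma u) (gamma v)) x0 x0 ->
  continuity_2d_pt (fun u v => K (delta u) (delta v)) y0 y0 ->
  continuity_2d_pt (fun u v => K (gamma u) (delta v)) x0 y0.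
Proof.
  assert (Hincr : forall (eta : R -> T) z0, locally z0 (fun z => D (eta z)) ->
    positive_on D K -> continuity_2d_pt (fun u v => K (eta u) (eta v)) z0 z0 ->
    forall M, 0 < M -> forall eps, 0 < eps -> exists d, 0 < d /\
    forall z q, Rabs (z - z0) < d -> D q -> K q q <= M ->
      Rabs (K (eta z) q - K (eta z0) q) <= eps).
  { intros eta z0 [r Hr] HK Hc M HM eps Heps.
    assert (Pe : 0 < eps * eps / M / 4)
      by (apply Rdiv_lt_0_compat; [apply Rdiv_lt_0_compat; [nra | auto] | lra]).
    destruct (Hc (mkposreal _ Pe)) as [d Hd]; simpl in Hd.
    pose proof (cond_pos d); pose proof (cond_pos r).
    exists (Rmin d r); split; [now apply Rmin_pos |].
    intros z q Hz Hq HqM.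
    pose proof (Rmin_l d r); pose proof (Rmin_r d r).
    set (l := [(1, eta z); (-1, eta z0)]).
    replace (K (eta z) q - K (eta z0) q) with (form K l [(1, q)])
      by (unfold l, form; simpl; ring).
    assert (Hl : supported D l).
    { intros a; simpl; intros [<- | [<- | []]]; apply Hr;
        [change (Rabs (z - z0) < r); lra | apply ball_center]. }
    assert (Hq' : supported D [(1, q)]).
    { intros a; simpl; intros [<- | []]; auto. }
    apply sqr_le_Rabs; [lra |].
    eapply Rle_trans; [apply (cauchy_schwarz D K); auto |].
    assert (Hqq : form K [(1, q)] [(1, q)] = K q q) by (unfold form; simpl; ring).
    assert (Hll : form K l l <= eps * eps / M).
    { assert (Hz0 : Rabs (z0 - z0) < d)
        by (unfold Rminus; rewrite Rplus_opp_r, Rabs_R0; auto).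
      pose proof (Hd z z ltac:(lra) ltac:(lra)) as K1.
      pose proof (Hd z z0 ltac:(lra) Hz0) as K2.
      pose proof (Hd z0 z Hz0 ltac:(lra)) as K3.
      apply Rabs_def2 in K1, K2, K3.
      unfold l, form; simpl; lra. }
    eapply Rle_trans.
    { apply Rmult_le_compat; [now apply (form_nonneg D) | now apply (form_nonneg D) | exact Hll |].
      rewrite Hqq; exact HqM. }
    right; field; lra. }
  intros HK Hx Hy Hc Hc' eps.
  pose proof (cond_pos eps) as Pe.
  assert (Hx0 : D (gamma x0)) by (apply (locally_singleton _ _ Hx)).
  destruct (Hc' (mkposreal 1 Rlt_0_1)) as [r Hr]; simpl in Hr.
  set (M := Rabs (K (delta y0) (delta y0)) + 1).
  assert (HM : 0 < M) by (unfold M; pose proof (Rabs_pos (K (delta y0) (delta y0))); lra).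
  set (M' := Rabs (K (gamma x0) (gamma x0)) + 1).
  assert (HM' : 0 < M') by (unfold M'; pose proof (Rabs_pos (K (gamma x0) (gamma x0))); lra).
  destruct (Hincr gamma x0 Hx HK Hc M HM (eps / 4) ltac:(lra)) as [d [Hd Hb]].
  destruct (Hincr delta y0 Hy HK Hc' M' HM' (eps / 4) ltac:(lra)) as [d' [Hd' Hb']].
  destruct Hy as [ry Hy].
  pose proof (cond_pos r); pose proof (cond_pos ry).
  assert (Ps : 0 < Rmin (Rmin d d') (Rmin r ry)) by (repeat apply Rmin_pos; auto).
  exists (mkposreal _ Ps); simpl; intros u v Hu Hv.
  pose proof (Rmin_l (Rmin d d') (Rmin r ry)); pose proof (Rmin_r (Rmin d d') (Rmin r ry)).
  pose proof (Rmin_l d d'); pose proof (Rmin_r d d').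
  pose proof (Rmin_l r ry); pose proof (Rmin_r r ry).
  assert (HDv : D (delta v)) by (apply Hy; change (Rabs (v - y0) < ry); lra).
  assert (HDy0 : D (delta y0)) by (apply Hy, ball_center).
  specialize (Hb u (delta v) ltac:(lra) HDv).
  specialize (Hb' v (gamma x0) ltac:(lra) Hx0).
  rewrite (kernel_sym _ _ HK (delta v)), (kernel_sym _ _ HK (delta y0)) in Hb' by auto.
  specialize (Hr v v ltac:(lra) ltac:(lra)).
  apply Rabs_def2 in Hr.
  pose proof (Rle_abs (K (delta y0) (delta y0))).
  pose proof (Rle_abs (K (gamma x0) (gamma x0))).
  specialize (Hb ltac:(unfold M; lra)).
  specialize (Hb' ltac:(unfold M'; lra)).
  replace (K (gamma u) (delta v) - K (gamma x0) (delta y0)) with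
    ((K (gamma u) (delta v) - K (gamma x0) (delta v)) +
     (K (gamma x0) (delta v) - K (gamma x0) (delta y0))) by ring.
  eapply Rle_lt_trans; [apply Rabs_triang | lra].
Qed.

(** * Positivity of limits *)

Lemma is_lim_of_bound (F : R -> R) (l : R) :
  (forall eps, 0 < eps -> exists d, 0 < d /\
     forall h, h <> 0 -> Rabs h < d -> Rabs (F h - l) <= eps) ->
  is_lim F 0 l.
Proof.
  intros H; apply is_lim_spec; intros eps; simpl.
  pose proof (cond_pos eps).
  destruct (H (eps / 2) ltac:(lra)) as [d [Hd Hb]].
  exists (mkposreal d Hd); intros h Hh Hh0.
  change (Rabs (h - 0) < d) in Hh; rewrite Rminus_0_r in Hh.
  specialize (Hb h Hh0 Hh); lra.
Qed.

Lemma is_lim_difference_quotient (g : R -> R) (x l : R) :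
  is_derive g x l -> is_lim (fun h => (g (x + h) - g x) / h) 0 l.
Proof.
  intros H; apply is_derive_Reals in H.
  apply is_lim_of_bound; intros eps Heps.
  destruct (H eps Heps) as [d Hd].
  exists d; split; [apply cond_pos |].
  intros h Hh0 Hh; apply Rlt_le; auto.
Qed.

Lemma is_lim_sum_over {A : Type} (F : A -> R -> R) (G : A -> R) (l : list A) :
  (forall a, In a l -> is_lim (F a) 0 (G a)) ->
  is_lim (fun h => sum_over (fun a => F a h) l) 0 (sum_over G l).
Proof.
  induction l as [|a l IH]; intros H; simpl.
  - apply is_lim_const.
  - apply is_lim_plus'; [apply H; simpl; auto |].
    apply IH; intros b Hb; apply H; simpl; auto.
Qed.

Definition substitute {T : Type} (A : T -> list (R * T)) (l : list (R * T))
  : list (R * T) :=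
  flat_map (fun a => scale (fst a) (A (snd a))) l.

Lemma form_substitute {T : Type} (K : T -> T -> R) (A : T -> list (R * T))
    (l l' : list (R * T)) :
  form K (substitute A l) (substitute A l') =
  sum_over (fun a => sum_over (fun b =>
    fst a * fst b * form K (A (snd a)) (A (snd b))) l') l.
Proof.
  assert (Hr : forall m m', form K m (substitute A m') =
    sum_over (fun b => fst b * form K m (A (snd b))) m').
  { intros m m'; induction m' as [|b m' IH]; simpl.
    - apply sum_over_zero.
    - now rewrite form_app_r, form_scale_r, IH. }
  induction l as [|a l IH]; simpl; [reflexivity |].
  rewrite form_app_l, form_scale_l, IH, Hr, <- sum_over_scal.
  f_equal; apply sum_over_ext; intros b _; ring.
Qed.

(** If every point of D' is a weak limit of combinations A h p of points of D, that
    is, if the Gram matrix of the combinations converges to K, then the form on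
    D' is a limit of nonnegative numbers. *)
Lemma positivity_limit {T : Type} (D D' : T -> Prop) (K : T -> T -> R)
    (A : R -> T -> list (R * T)) :
  positive_on D K ->
  (forall p, D' p -> locally 0 (fun h => supported D (A h p))) ->
  (forall p q, D' p -> D' q -> is_lim (fun h => form K (A h p) (A h q)) 0 (K p q)) ->
  forall l, supported D' l -> 0 <= form K l l.
Proof.
  intros HK Hs HA l Hl.
  assert (Hlim : is_lim (fun h => form K (substitute (A h) l) (substitute (A h) l)) 0
                   (form K l l)).
  { apply (is_lim_ext (fun h => sum_over (fun a => sum_over (fun b =>
      fst a * fst b * form K (A h (snd a)) (A h (snd b))) l) l)).
    { intros h; symmetry; apply form_substitute. }
    apply (is_lim_sum_over (fun a h => sum_over (fun b =>
      fst a * fst b * form K (A h (snd a)) (A h (snd b))) l)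
      (fun a => sum_over (fun b => fst a * fst b * K (snd a) (snd b)) l)).
    intros a Ha.
    apply (is_lim_sum_over (fun b h =>
      fst a * fst b * form K (A h (snd a)) (A h (snd b)))
      (fun b => fst a * fst b * K (snd a) (snd b))).
    intros b Hb.
    apply (is_lim_scal_l _ (fst a * fst b) 0 (Finite (K (snd a) (snd b)))).
    apply HA; auto. }
  assert (Hev : locally 0 (fun h => supported D (substitute (A h) l))).
  { clear Hlim; induction l as [|a l IH].
    - exists (mkposreal 1 Rlt_0_1); intros h _ b [].
    - assert (H1 : locally 0 (fun h => supported D (A h (snd a))))
        by (apply Hs, Hl; simpl; auto).
      assert (H2 : locally 0 (fun h => supported D (substitute (A h) l)))
        by (apply IH; intros b Hb; apply Hl; simpl; auto).
      generalize (filter_and _ _ H1 H2); apply filter_imp.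
      intros h [K1 K2]; apply supported_app; [now apply supported_scale | exact K2]. }
  refine (is_lim_le_loc (fun _ => 0) _ 0 0 (form K l l) _ (is_lim_const 0 0) Hlim).
  destruct Hev as [r Hr]; exists r; intros h Hh _.
  apply (form_nonneg D); auto.
Qed.

(** * Real partial derivatives near the diagonal *)

Definition rpartial (i j : nat) (g : R -> R -> R) (u v : R) : R :=
  Derive_n (fun y => Derive_n (fun x => g x y) i u) j v.

Record real_class_S (n : nat) (U : R * R -> Prop) (g : R -> R -> R) : Prop := {
  class_derive_u : forall i u v, (i < n)%nat -> U (u, v) ->
    ex_derive (fun x => rpartial i 0 g x v) u;
  class_derive_v : forall i j u v, (i <= n)%nat -> (j < n)%nat -> U (u, v) ->
    ex_derive (rpartial i j g u) v;
  class_continuous : forall i j u v, (i <= n)%nat -> (j <= n)%nat -> U (u, v) ->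
    continuity_2d_pt (rpartial i j g) u v }.

Lemma open_locally_2d (U : R * R -> Prop) (u v : R) :
  open U -> U (u, v) -> locally_2d (fun x y => U (x, y)) u v.
Proof.
  intros HU H; apply locally_2d_locally.
  generalize (HU _ H); apply filter_imp; intros [x y]; auto.
Qed.

Lemma locally_2d_imp (P Q : R -> R -> Prop) (u v : R) :
  (forall x y, P x y -> Q x y) -> locally_2d P u v -> locally_2d Q u v.
Proof. intros H [d Hd]; exists d; auto. Qed.

Lemma locally_2d_swap (P : R -> R -> Prop) (u v : R) :
  locally_2d P u v -> locally_2d (fun x y => P y x) v u.
Proof. intros [d Hd]; exists d; auto. Qed.

Lemma continuity_2d_pt_swap (f : R -> R -> R) (u v : R) :
  continuity_2d_pt f u v -> continuity_2d_pt (fun x y => f y x) v u.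
Proof. intros H eps; exact (locally_2d_swap _ _ _ (H eps)). Qed.

(** The class only provides derivatives in which those in the first variable come
    first. Exchanging one derivative in u with the derivatives in v, one at a
    time, shows that the first variable may also be differentiated last. *)
Lemma rpartial_derive_u (n : nat) (U : R * R -> Prop) (g : R -> R -> R) :
  open U -> real_class_S n U g ->
  forall i j u v, (i < n)%nat -> (j <= n)%nat -> U (u, v) ->
    is_derive (fun x => rpartial i j g x v) u (rpartial (S i) j g u v).
Proof.
  intros HU Hg i j; induction j as [|j IH]; intros u v Hi Hj Huv.
  - apply Derive_correct, (class_derive_u n U g Hg); auto.
  - assert (Hloc := open_locally_2d U u v HU Huv).
    apply (is_derive_mixed_swap (rpartial i j g) (rpartial (S i) j g)
             (rpartial i (S j) g) (rpartial (S i) (S j) g)).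
    + revert Hloc; apply locally_2d_imp; intros x y Hxy; apply IH; auto; lia.
    + revert Hloc; apply locally_2d_imp; intros x y Hxy.
      apply Derive_correct, (class_derive_v n U g Hg); auto; lia.
    + apply (class_continuous n U g Hg); auto.
    + generalize (locally_2d_1d_const_y _ _ _ Hloc); apply filter_imp.
      intros x Hxv; apply Derive_correct, (class_derive_v n U g Hg); auto; lia.
Qed.

(** Smoothness near the diagonal is used in this form: there, the partial
    derivative of order (m, m) has a continuous mixed second derivative. *)
Lemma class_diagonal_asymptotic (n m : nat) (U : R * R -> Prop) (g : R -> R -> R)
    (x0 : R) :
  open U -> real_class_S n U g -> (m < n)%nat -> U (x0, x0) ->
  diagonal_asymptotic (rpartial m m g) x0 (rpartial (S m) (S m) g x0 x0).
Proof.
  intros HU Hg Hm Hx eps Heps.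
  assert (Hloc := open_locally_2d U x0 x0 HU Hx).
  destruct (mixed_difference_asymptotic (rpartial m m g) (rpartial (S m) m g)
              (rpartial (S m) (S m) g) x0 x0) with (eps := eps) as [d [Hd Hb]]; auto.
  - revert Hloc; apply locally_2d_imp; intros x y Hxy.
    apply (rpartial_derive_u n U); auto; lia.
  - revert Hloc; apply locally_2d_imp; intros x y Hxy.
    apply Derive_correct, (class_derive_v n U g Hg); auto.
  - apply (class_continuous n U g Hg); auto.
  - exists d; split; auto.
Qed.

(** * Jets of a family of kernels *)

(** The jet (i, e, x) stands for the i-th derivative at x of the curve e of
    vectors. *)
Definition jet (E : Type) : Type := (nat * E * R)%type.

Definition jet_kernel {E : Type} (k : E -> E -> R -> R -> R) (p q : jet E) : R :=
  let '(i, e, x) := p in let '(j, f, y) := q in rpartial i j (k e f) x y.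

Definition jet_domain {E : Type} (Omega : R -> Prop) (m : nat) (p : jet E) : Prop :=
  let '(i, _, x) := p in (i <= m)%nat /\ Omega x.

Record regular_jets {E : Type} (Omega : R -> Prop) (k : E -> E -> R -> R -> R)
    (m : nat) : Prop := {
  jets_positive : positive_on (jet_domain Omega m) (jet_kernel k);
  jets_class : forall e f, real_class_S m (square Omega) (k e f) }.

Lemma square_open (Omega : R -> Prop) (u v : R) :
  open Omega -> Omega u -> Omega v ->
  locally_2d (fun x y => Omega x /\ Omega y) u v.
Proof.
  intros HO Hu Hv.
  destruct (HO u Hu) as [r1 H1]; destruct (HO v Hv) as [r2 H2].
  assert (P : 0 < Rmin r1 r2) by (apply Rmin_pos; apply cond_pos).
  exists (mkposreal _ P); simpl; intros x y Hx Hy.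
  split; [apply H1 | apply H2].
  - change (Rabs (x - u) < r1); eapply Rlt_le_trans; [exact Hx | apply Rmin_l].
  - change (Rabs (y - v) < r2); eapply Rlt_le_trans; [exact Hy | apply Rmin_r].
Qed.

Definition diagonally_smooth {E : Type} (Omega : R -> Prop)
    (k : E -> E -> R -> R -> R) (m : nat) : Prop :=
  forall e x, Omega x -> exists c, diagonal_asymptotic (rpartial m m (k e e)) x c.

Lemma jet_quotients_cauchy {E : Type} (Omega : R -> Prop)
    (k : E -> E -> R -> R -> R) (m j : nat) (e f : E) (u v : R) :
  open Omega -> regular_jets Omega k m -> diagonally_smooth Omega k m ->
  (j <= m)%nat -> Omega u -> Omega v ->
  cauchy_quotients (rpartial m j (k e f)) u v.
Proof.
  intros HO [HK Hc] Hd Hj Hu Hv.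
  destruct (Hd e u Hu) as [c Hcu].
  apply (kernel_cauchy_quotients (jet_domain Omega m) (jet_kernel k)
           (fun x => (m, e, x)) (fun y => (j, f, y)) u v c); auto.
  - generalize (HO u Hu); apply filter_imp; simpl; auto.
  - generalize (HO v Hv); apply filter_imp; simpl; auto.
  - apply (class_continuous m _ _ (Hc f f)); auto; split; auto.
Qed.

Lemma jet_derive_u {E : Type} (Omega : R -> Prop)
    (k : E -> E -> R -> R -> R) (m j : nat) (e f : E) (u v : R) :
  open Omega -> regular_jets Omega k m -> diagonally_smooth Omega k m ->
  (j <= m)%nat -> Omega u -> Omega v ->
  ex_derive (fun x => rpartial m j (k e f) x v) u /\
  continuity_2d_pt (fun u v => Derive (fun x => rpartial m j (k e f) x v) u) u v.
Proof.
  intros HO Hk Hd Hj Hu Hv.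
  assert (Hq := jet_quotients_cauchy Omega k m j e f).
  split.
  - apply cauchy_quotients_ex_derive, Hq; auto.
  - apply cauchy_quotients_continuity.
    + apply Hq; auto.
    + generalize (square_open Omega u v HO Hu Hv); apply locally_2d_imp.
      intros x y [Hx Hy]; apply cauchy_quotients_ex_derive, Hq; auto.
    + generalize (square_open Omega u v HO Hu Hv); apply locally_2d_imp.
      intros x y [Hx Hy].
      apply (class_continuous m _ _ (jets_class _ _ _ Hk e f)); auto; split; auto.
Qed.

(** The derivative in u of the partial derivative of order (m, j) is the one of
    order (m + 1, j), although the latter takes its derivatives in v last: by
    induction on j, the last derivative in v is exchanged with the one in u. *)
Lemma jet_derive_succ {E : Type} (Omega : R -> Prop)
    (k : E -> E -> R -> R -> R) (m : nat) (e f : E) :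
  open Omega -> regular_jets Omega k m -> diagonally_smooth Omega k m ->
  forall j u v, (j <= m)%nat -> Omega u -> Omega v ->
  is_derive (fun x => rpartial m j (k e f) x v) u (rpartial (S m) j (k e f) u v) /\
  ((j < m)%nat -> ex_derive (rpartial (S m) j (k e f) u) v).
Proof.
  intros HO Hk Hd.
  assert (Hu' := fun j u v => jet_derive_u Omega k m j e f u v HO Hk Hd).
  assert (Hswap : forall j u v, (S j <= m)%nat -> Omega u -> Omega v ->
    (forall x y, Omega x -> Omega y -> is_derive (fun x => rpartial m j (k e f) x y) x
        (rpartial (S m) j (k e f) x y)) ->
    is_derive (rpartial (S m) j (k e f) u) v
      (Derive (fun x => rpartial m (S j) (k e f) x v) u)).
  { intros j u v Hj Hu Hv Hder.
    assert (Hloc := locally_2d_swap _ _ _ (square_open Omega u v HO Hu Hv)).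
    apply (is_derive_mixed_swap (fun b a => rpartial m j (k e f) a b)
      (fun b a => rpartial m (S j) (k e f) a b)
      (fun b a => rpartial (S m) j (k e f) a b)
      (fun b a => Derive (fun x => rpartial m (S j) (k e f) x b) a)).
    - revert Hloc; apply locally_2d_imp; intros b a [Ha Hb].
      apply Derive_correct, (class_derive_v m _ _ (jets_class _ _ _ Hk e f));
        auto; split; auto.
    - revert Hloc; apply locally_2d_imp; intros b a [Ha Hb].
      apply Derive_correct, Hu'; auto.
    - apply continuity_2d_pt_swap, Hu'; auto.
    - generalize (HO v Hv); apply filter_imp; intros b Hb; auto. }
  assert (Hmain : forall j u v, (j <= m)%nat -> Omega u -> Omega v ->
    is_derive (fun x => rpartial m j (k e f) x v) u (rpartial (S m) j (k e f) u v)).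
  { intros j; induction j as [|j IH]; intros u v Hj Hu Hv.
    - apply Derive_correct, Hu'; auto.
    - change (rpartial (S m) (S j) (k e f) u v)
        with (Derive (rpartial (S m) j (k e f) u) v).
      rewrite (is_derive_unique _ _ _ (Hswap j u v Hj Hu Hv
        (fun x y Hx Hy => IH x y ltac:(lia) Hx Hy))).
      apply Derive_correct, Hu'; auto. }
  intros j u v Hj Hu Hv; split; [auto |].
  intros Hjm; eexists; apply Hswap; auto.
Qed.

(** Along both variables at once: the corner order (m + 1, m + 1) is the only one
    that differentiates two jets of order m. *)
Lemma jet_derive_diagonal {E : Type} (Omega : R -> Prop)
    (k : E -> E -> R -> R -> R) (m : nat) (e f : E) (u v : R) :
  open Omega -> regular_jets Omega k m -> diagonally_smooth Omega k m ->
  Omega u -> Omega v ->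
  ex_derive (rpartial (S m) m (k e f) u) v /\
  continuity_2d_pt (rpartial (S m) (S m) (k e f)) u v.
Proof.
  intros HO Hk Hd Hu Hv.
  assert (Hder := jet_derive_succ Omega k m e f HO Hk Hd m).
  assert (Hq : forall x y, Omega x -> Omega y ->
    cauchy_quotients (fun b a => rpartial (S m) m (k e f) a b) y x).
  { intros x y Hx Hy.
    destruct (Hd e x Hx) as [c Hc]; destruct (Hd f y Hy) as [c' Hc'].
    apply (kernel_derivative_cauchy_quotients (jet_domain Omega m) (jet_kernel k)
             (fun x => (m, e, x)) (fun y => (m, f, y))
             (rpartial (S m) m (k e f)) x y c c'); auto.
    - apply (jets_positive _ _ _ Hk).
    - generalize (HO x Hx); apply filter_imp; simpl; auto.
    - generalize (HO y Hy); apply filter_imp; simpl; auto.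
    - generalize (square_open Omega x y HO Hx Hy); apply locally_2d_imp.
      intros a b [Ha Hb]; apply Hder; auto. }
  split.
  - apply (cauchy_quotients_ex_derive _ _ _ (Hq u v Hu Hv)).
  - apply (continuity_2d_pt_swap (fun b a => rpartial (S m) (S m) (k e f) a b)).
    apply (cauchy_quotients_continuity (fun b a => rpartial (S m) m (k e f) a b)).
    + apply Hq; auto.
    + generalize (square_open Omega v u HO Hv Hu); apply locally_2d_imp.
      intros y x [Hy Hx]; apply (cauchy_quotients_ex_derive _ _ _ (Hq x y Hx Hy)).
    + generalize (square_open Omega v u HO Hv Hu); apply locally_2d_imp.
      intros y x [Hy Hx]; apply continuity_2d_pt_swap.
      apply (continuity_2d_pt_ext_loc
        (fun a b => Derive (fun z => rpartial m m (k e f) z b) a)).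
      * generalize (square_open Omega x y HO Hx Hy); apply locally_2d_imp.
        intros a b [Ha Hb]; apply is_derive_unique, Hder; auto.
      * apply jet_derive_u with (Omega := Omega); auto.
Qed.

Lemma jet_sym {E : Type} (Omega : R -> Prop) (k : E -> E -> R -> R -> R)
    (m i j : nat) (e f : E) (u v : R) :
  regular_jets Omega k m -> (i <= m)%nat -> (j <= m)%nat -> Omega u -> Omega v ->
  rpartial i j (k e f) u v = rpartial j i (k f e) v u.
Proof.
  intros Hk Hi Hj Hu Hv.
  apply (kernel_sym _ _ (jets_positive _ _ _ Hk) (i, e, u) (j, f, v)); simpl; auto.
Qed.

(** * From order m to order m + 1 *)

(** Symmetry of the kernel turns derivatives in v into derivatives in u. The right
    hand side is also the partial derivative of order (i, m + 1), which yields
    the symmetry between a row and a column of new orders. *)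
Lemma jet_derive_v {E : Type} (Omega : R -> Prop) (k : E -> E -> R -> R -> R)
    (m i : nat) (e f : E) (u v : R) :
  open Omega -> regular_jets Omega k m -> diagonally_smooth Omega k m ->
  (i <= m)%nat -> Omega u -> Omega v ->
  is_derive (rpartial i m (k e f) u) v (rpartial (S m) i (k f e) v u).
Proof.
  intros HO Hk Hd Hi Hu Hv.
  apply (is_derive_ext_loc (fun t => rpartial m i (k f e) t u)).
  - generalize (HO v Hv); apply filter_imp; intros t Ht.
    apply (jet_sym Omega k m); auto.
  - apply (jet_derive_succ Omega k m f e HO Hk Hd i v u); auto.
Qed.

(** The symmetric kernel of order (m, m) is differentiated once in each variable;
    exchanging the two curves exchanges the order of these derivatives. *)
Lemma jet_corner {E : Type} (Omega : R -> Prop) (k : E -> E -> R -> R -> R)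
    (m : nat) (e f : E) (u v : R) :
  open Omega -> regular_jets Omega k m -> diagonally_smooth Omega k m ->
  Omega u -> Omega v ->
  rpartial (S m) (S m) (k e f) u v = rpartial (S m) (S m) (k f e) v u.
Proof.
  intros HO Hk Hd Hu Hv.
  assert (Hloc := square_open Omega u v HO Hu Hv).
  assert (H : is_derive (fun t => rpartial m (S m) (k e f) t v) u
                (rpartial (S m) (S m) (k e f) u v)).
  { apply (is_derive_mixed_swap (rpartial m m (k e f)) (rpartial (S m) m (k e f))
             (rpartial m (S m) (k e f)) (rpartial (S m) (S m) (k e f))).
    - revert Hloc; apply locally_2d_imp; intros x y [Hx Hy].
      apply (jet_derive_succ Omega k m e f HO Hk Hd m); auto.
    - revert Hloc; apply locally_2d_imp; intros x y [Hx Hy].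
      apply Derive_correct, (jet_derive_diagonal Omega k m); auto.
    - apply (jet_derive_diagonal Omega k m); auto.
    - generalize (HO u Hu); apply filter_imp; intros x Hx.
      apply Derive_correct; eexists; apply (jet_derive_v Omega k m); auto. }
  rewrite <- (is_derive_unique _ _ _ H).
  apply Derive_ext_loc.
  generalize (HO u Hu); apply filter_imp; intros x Hx.
  apply is_derive_unique, (jet_derive_v Omega k m); auto.
Qed.

Lemma jet_sym_succ {E : Type} (Omega : R -> Prop) (k : E -> E -> R -> R -> R)
    (m i j : nat) (e f : E) (u v : R) :
  open Omega -> regular_jets Omega k m -> diagonally_smooth Omega k m ->
  (i <= S m)%nat -> (j <= S m)%nat -> Omega u -> Omega v ->
  rpartial i j (k e f) u v = rpartial j i (k f e) v u.
Proof.
  intros HO Hk Hd Hi Hj Hu Hv.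
  destruct (Nat.eq_dec i (S m)) as [-> | Hi'], (Nat.eq_dec j (S m)) as [-> | Hj'].
  - apply (jet_corner Omega k m); auto.
  - symmetry; apply is_derive_unique, (jet_derive_v Omega k m); auto; lia.
  - apply is_derive_unique, (jet_derive_v Omega k m); auto; lia.
  - apply (jet_sym Omega k m); auto; lia.
Qed.

Lemma jets_class_succ {E : Type} (Omega : R -> Prop) (k : E -> E -> R -> R -> R)
    (m : nat) (e f : E) :
  open Omega -> regular_jets Omega k m -> diagonally_smooth Omega k m ->
  real_class_S (S m) (square Omega) (k e f).
Proof.
  intros HO Hk Hd.
  assert (Hold := fun e f => jets_class _ _ _ Hk e f).
  assert (Hrow : forall e f j u v, (j <= m)%nat -> Omega u -> Omega v ->
    continuity_2d_pt (rpartial (S m) j (k e f)) u v).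
  { intros e' f' j u v Hj Hu Hv.
    apply (continuity_2d_pt_ext_loc
      (fun a b => Derive (fun x => rpartial m j (k e' f') x b) a)).
    - generalize (square_open Omega u v HO Hu Hv); apply locally_2d_imp.
      intros a b [Ha Hb]; apply is_derive_unique.
      apply (jet_derive_succ Omega k m e' f' HO Hk Hd j); auto.
    - apply (jet_derive_u Omega k m); auto. }
  split.
  - intros i u v Hi [Hu Hv]; simpl in Hu, Hv.
    destruct (Nat.eq_dec i m) as [-> | Hi'].
    + apply (jet_derive_u Omega k m); auto; lia.
    + apply (class_derive_u m _ _ (Hold e f)); [lia | split; auto].
  - intros i j u v Hi Hj [Hu Hv]; simpl in Hu, Hv.
    destruct (Nat.eq_dec i (S m)) as [-> | Hi'], (Nat.eq_dec j m) as [-> | Hj'].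
    + apply (jet_derive_diagonal Omega k m); auto.
    + apply (jet_derive_succ Omega k m e f HO Hk Hd j); auto; lia.
    + eexists; apply (jet_derive_v Omega k m); auto; lia.
    + apply (class_derive_v m _ _ (Hold e f)); [lia | lia | split; auto].
  - intros i j u v Hi Hj [Hu Hv]; simpl in Hu, Hv.
    destruct (Nat.eq_dec i (S m)) as [-> | Hi'], (Nat.eq_dec j (S m)) as [-> | Hj'].
    + apply (jet_derive_diagonal Omega k m); auto.
    + apply Hrow; auto; lia.
    + apply (continuity_2d_pt_ext_loc (fun a b => rpartial (S m) i (k f e) b a)).
      * generalize (square_open Omega u v HO Hu Hv); apply locally_2d_imp.
        intros a b [Ha Hb]; apply (jet_sym_succ Omega k m); auto.
      * apply continuity_2d_pt_swap, Hrow; auto; lia.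
    + apply (class_continuous m _ _ (Hold e f)); [lia | lia | split; auto].
Qed.

(** A jet of order m + 1 is approximated by a difference quotient of jets of
    order m; the jets of order at most m stay as they are. *)
Definition jet_difference {E : Type} (m : nat) (h : R) (p : jet E)
  : list (R * jet E) :=
  let '(i, e, x) := p in
  if (i <=? m)%nat then [(1, p)] else [(/ h, (m, e, x + h)); (- / h, (m, e, x))].

Lemma jets_positive_succ {E : Type} (Omega : R -> Prop) (k : E -> E -> R -> R -> R)
    (m : nat) :
  open Omega -> regular_jets Omega k m -> diagonally_smooth Omega k m ->
  positive_on (jet_domain Omega (S m)) (jet_kernel k).
Proof.
  intros HO Hk Hd; split.
  { intros [[i e] x] [[j f] y] [Hi Hx] [Hj Hy]; apply (jet_sym_succ Omega k m); auto. }
  apply (positivity_limit (jet_domain Omega m) _ _ (jet_difference m)).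
  - apply (jets_positive _ _ _ Hk).
  - intros [[i e] x] [Hi Hx]; unfold jet_difference.
    destruct (Nat.leb_spec i m) as [Him | Him].
    + apply filter_forall; intros h a [<- | []]; split; auto.
    + destruct (HO x Hx) as [r Hr]; exists r; intros h Hh.
      intros a [<- | [<- | []]]; split; auto.
      apply Hr; change (Rabs (x + h - x) < r); change (Rabs (h - 0) < r) in Hh.
      now replace (x + h - x) with (h - 0) by ring.
  - intros [[i e] x] [[j f] y] [Hi Hx] [Hj Hy]; unfold jet_difference.
    destruct (Nat.leb_spec i m) as [Him | Him], (Nat.leb_spec j m) as [Hjm | Hjm].
    + apply (is_lim_ext (fun _ => rpartial i j (k e f) x y)).
      * intros h; unfold form; simpl; ring.
      * apply is_lim_const.
    + replace j with (S m) by lia.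
      apply (is_lim_ext (fun h =>
        (rpartial i m (k e f) x (y + h) - rpartial i m (k e f) x y) / h)).
      * intros h; unfold form; simpl; unfold Rdiv; ring.
      * apply is_lim_difference_quotient, Derive_correct.
        eexists; apply (jet_derive_v Omega k m); auto.
    + replace i with (S m) by lia.
      apply (is_lim_ext (fun h =>
        (rpartial m j (k e f) (x + h) y - rpartial m j (k e f) x y) / h)).
      * intros h; unfold form; simpl; unfold Rdiv; ring.
      * apply (is_lim_difference_quotient (fun t => rpartial m j (k e f) t y)).
        apply (jet_derive_succ Omega k m e f HO Hk Hd j); auto.
    + replace i with (S m) by lia; replace j with (S m) by lia.
      apply (is_lim_ext (fun h =>
        mixed_difference (rpartial m m (k e f)) x y h h * (/ h * / h))).
      * intros h; unfold form, mixed_difference; simpl; ring.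
      * change (jet_kernel k (S m, e, x) (S m, f, y))
          with (rpartial (S m) (S m) (k e f) x y).
        apply is_lim_of_bound; intros eps Heps.
        assert (Hloc := square_open Omega x y HO Hx Hy).
        destruct (mixed_difference_asymptotic (rpartial m m (k e f))
          (rpartial (S m) m (k e f)) (rpartial (S m) (S m) (k e f)) x y)
          with (eps := eps) as [d [Hd0 Hb]]; auto.
        { revert Hloc; apply locally_2d_imp; intros a b [Ha Hb].
          apply (jet_derive_succ Omega k m e f HO Hk Hd m); auto. }
        { revert Hloc; apply locally_2d_imp; intros a b [Ha Hb].
          apply Derive_correct, (jet_derive_diagonal Omega k m); auto. }
        { apply (jet_derive_diagonal Omega k m); auto. }
        exists d; split; auto; intros h Hh0 Hh.
        assert (Hself : forall z, Rabs (z - z) < d).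
        { intros z; unfold Rminus; rewrite Rplus_opp_r, Rabs_R0; auto. }
        specialize (Hb x y h h (Hself x) (Hself y) Hh Hh).
        pose proof (Rabs_pos_lt h Hh0) as Hp.
        apply (Rmult_le_reg_r (Rabs h * Rabs h)); [now apply Rmult_lt_0_compat |].
        rewrite <- !Rabs_mult.
        rewrite <- Rabs_mult in Hb.
        match goal with |- Rabs ?z <= _ => match type of Hb with Rabs ?w <= _ =>
          replace z with w by (field; auto) end end.
        exact Hb.
Qed.

(** Only the kernels k e e, and only near the diagonal, are supposed to be regular:
    by Cauchy-Schwarz the products of two different curves are controlled by
    the norms along each of them. *)
Theorem real_kernel_regularity {E : Type} (n : nat) (Omega : R -> Prop)
    (k : E -> E -> R -> R -> R) (U : R * R -> Prop) :
  open Omega -> open U -> (forall x, Omega x -> U (x, x)) ->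
  positive_on (jet_domain Omega 0) (jet_kernel k) ->
  (forall e, real_class_S n U (k e e)) ->
  forall e f, real_class_S n (square Omega) (k e f).
Proof.
  intros HO HU Hdiag HK Hn.
  assert (Hjets : forall m, (m <= n)%nat -> regular_jets Omega k m).
  { induction m as [|m IH]; intros Hm.
    - split; [exact HK |]; intros e f; split; try lia.
      intros i j u v Hi Hj [Hu Hv]; simpl in Hu, Hv.
      replace i with 0%nat by lia; replace j with 0%nat by lia.
      apply (kernel_continuity (jet_domain Omega 0) (jet_kernel k)
               (fun x => (0%nat, e, x)) (fun y => (0%nat, f, y))); auto.
      + generalize (HO u Hu); apply filter_imp; simpl; auto.
      + generalize (HO v Hv); apply filter_imp; simpl; auto.
      + apply (class_continuous n U _ (Hn e)); auto; lia.
      + apply (class_continuous n U _ (Hn f)); auto; lia.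
    - specialize (IH ltac:(lia)).
      assert (Hd : diagonally_smooth Omega k m).
      { intros e x Hx; eexists; apply (class_diagonal_asymptotic n m U); auto. }
      split.
      + apply jets_positive_succ; auto.
      + intros e f; apply jets_class_succ; auto. }
  intros e f; apply (jets_class _ _ _ (Hjets n (le_n n))).
Qed.

(** * Complex kernels *)

(** The real inner products of the vectors phi x (index true) and i phi x (index
    false), where k x y = <phi x, phi y>. *)
Definition real_components (k : R -> R -> C) (e f : bool) (x y : R) : R :=
  match e, f with
  | true, true | false, false => Re (k x y)
  | true, false => Im (k x y)
  | false, true => - Im (k x y)
  end.

Definition realified_weight (c : R) (e : bool) : C := if e then (c, 0) else (0, c).

Lemma Re_sum_n_m_list {A : Type} (F : A -> C) (d : A) (l : list A) :
  Re (sum_n_m (fun i => F (nth (i - 1) l d)) 1 (length l)) =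
  sum_over (fun a => Re (F a)) l.
Proof.
  induction l as [|a l IH]; simpl length.
  - rewrite sum_n_m_zero by lia; reflexivity.
  - rewrite sum_Sn_m by lia.
    transitivity (Re (F a) +
      Re (sum_n_m (fun i => F (nth (i - 1) (a :: l) d)) 2 (S (length l))));
      [reflexivity |].
    rewrite <- sum_n_m_S; simpl sum_over; rewrite <- IH.
    f_equal; f_equal; apply sum_n_m_ext_loc; intros i Hi.
    replace (S i - 1)%nat with (S (i - 1)) by lia; reflexivity.
Qed.

(** The form is real at the weights (1, 1) and (1, i) on the points x and y, which
    gives the imaginary and the real part respectively. *)
Lemma kernel_hermitian (Omega : R -> Prop) (k : R -> R -> C) (x y : R) :
  positive_definite_kernel Omega k -> Omega x -> Omega y ->
  Re (k x y) = Re (k y x) /\ Im (k x y) = - Im (k y x).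
Proof.
  intros Hk Hx Hy.
  set (pt := fun i => match i with 1%nat => x | _ => y end).
  assert (Hpt : forall j, Omega (pt j)) by (intros [|[|j]]; simpl; auto).
  assert (Hdiag : forall z, Omega z -> Im (k z z) = 0).
  { intros z Hz.
    destruct (Hk 1%nat (fun _ => z) (fun _ => (1, 0)) ltac:(auto)) as [_ H].
    rewrite !sum_n_n in H; simpl in H; unfold Im in *; lra. }
  pose proof (Hdiag x Hx) as Dx; pose proof (Hdiag y Hy) as Dy.
  assert (H2 : forall xi : nat -> C,
    Im ((k x x * xi 1%nat * Cconj (xi 1%nat) + k x y * xi 1%nat * Cconj (xi 2%nat)) +
        (k y x * xi 2%nat * Cconj (xi 1%nat) + k y y * xi 2%nat * Cconj (xi 2%nat)))%C
      = 0).
  { intros xi; destruct (Hk 2%nat pt xi ltac:(auto)) as [_ H].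
    repeat first [rewrite (sum_n_Sm _ 1 1) in H by lia | rewrite sum_n_n in H].
    exact H. }
  pose proof (H2 (fun _ => (1, 0))) as E1.
  pose proof (H2 (fun i => match i with 1%nat => (1, 0) | _ => (0, 1) end)) as E2.
  unfold Re, Im in *; simpl in E1, E2; split; lra.
Qed.

(** A real combination of the vectors phi x and i phi x is a complex combination of
    the vectors phi x, and the two forms have the same value. *)
Lemma realified_positive (Omega : R -> Prop) (k : R -> R -> C) :
  positive_definite_kernel Omega k ->
  positive_on (jet_domain Omega 0) (jet_kernel (real_components k)).
Proof.
  intros Hk; split.
  - intros [[i e] x] [[j f] y] [Hi Hx] [Hj Hy].
    replace i with 0%nat by lia; replace j with 0%nat by lia.
    destruct (kernel_hermitian Omega k x y Hk Hx Hy) as [Hre Him].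
    destruct e, f; unfold jet_kernel, rpartial; simpl; lra.
  - intros l Hl.
    set (d := (0, (0%nat, true, 0)) : R * jet bool).
    set (pt := fun a : R * jet bool => snd (snd a)).
    set (xi := fun a : R * jet bool => realified_weight (fst a) (snd (fst (snd a)))).
    destruct (Hk (length l) (fun i => pt (nth (i - 1) l d))
                (fun i => xi (nth (i - 1) l d))) as [H _].
    { intros j Hj.
      assert (Hin : In (nth (j - 1) l d) l) by (apply nth_In; lia).
      apply Hl in Hin; destruct (nth (j - 1) l d) as [c [[i e] x]]; apply Hin. }
    rewrite (Re_sum_n_m_list (fun a => sum_n_m (fun j =>
      (k (pt a) (pt (nth (j - 1) l d)) * xi a * Cconj (xi (nth (j - 1) l d)))%C)
      1 (length l)) d l) in H.
    unfold form.
    rewrite (sum_over_ext _ (fun a => Re (sum_n_m (fun j =>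
      (k (pt a) (pt (nth (j - 1) l d)) * xi a * Cconj (xi (nth (j - 1) l d)))%C)
      1 (length l)))); [exact H |].
    intros a Ha.
    rewrite (Re_sum_n_m_list (fun b => (k (pt a) (pt b) * xi a * Cconj (xi b))%C) d l).
    apply sum_over_ext; intros b Hb.
    apply Hl in Ha; apply Hl in Hb.
    destruct a as [c [[i e] x]], b as [c' [[j f] y]].
    destruct Ha as [Hi _], Hb as [Hj _].
    replace i with 0%nat by lia; replace j with 0%nat by lia.
    unfold pt, xi, realified_weight, rpartial; simpl.
    destruct e, f; unfold rpartial, Re, Im; simpl; unfold Im, Re; ring.
Qed.

Lemma RCDerive_n_components (f : R -> C) (n : nat) (x : R) :
  RCDerive_n f n x =
  (Derive_n (fun t => Re (f t)) n x, Derive_n (fun t => Im (f t)) n x).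
Proof.
  revert x; induction n as [|n IH]; intros x; simpl.
  - apply surjective_pairing.
  - unfold RCDerive; f_equal; apply Derive_ext; intros t; now rewrite IH.
Qed.

Lemma partial_components (k : R -> R -> C) (i j : nat) (u v : R) :
  partial i j k u v =
  (rpartial i j (fun x y => Re (k x y)) u v, rpartial i j (fun x y => Im (k x y)) u v).
Proof.
  unfold partial, rpartial; rewrite RCDerive_n_components.
  f_equal; apply Derive_n_ext; intros t; now rewrite RCDerive_n_components.
Qed.

Lemma ex_derive_components (f : R -> C) (x : R) :
  ex_derive (V := C_R_NormedModule) f x <->
  ex_derive (fun t => Re (f t)) x /\ ex_derive (fun t => Im (f t)) x.
Proof.
  split.
  - intros [l Hl]; split.
    + exists (fst l).
      refine (filterdiff_comp f (fun z : C_R_NormedModule => fst z)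
        (fun y : R => scal y l : C_R_NormedModule)
        (fun z : C_R_NormedModule => fst z) Hl _).
      apply filterdiff_linear, (is_linear_fst (U := R_NormedModule) (V := R_NormedModule)).
    + exists (snd l).
      refine (filterdiff_comp f (fun z : C_R_NormedModule => snd z)
        (fun y : R => scal y l : C_R_NormedModule)
        (fun z : C_R_NormedModule => snd z) Hl _).
      apply filterdiff_linear, (is_linear_snd (U := R_NormedModule) (V := R_NormedModule)).
  - intros [[a Ha] [b Hb]].
    exists ((a, b) : C_R_NormedModule).
    apply (is_derive_ext (V := C_R_NormedModule) (fun t => (Re (f t), Im (f t)))).
    { intros t; symmetry; apply surjective_pairing. }
    refine (filterdiff_comp_2 (fun t => Re (f t)) (fun t => Im (f t))
      (fun c d => (c, d) : C_R_NormedModule)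
      (fun t : R => scal t a) (fun t : R => scal t b)
      (fun c d => (c, d) : C_R_NormedModule) Ha Hb _).
    apply (filterdiff_ext (fun z : R * R => z : C_R_NormedModule));
      [now intros [c d] |].
    apply (filterdiff_ext_lin _ (fun z : R * R => z : C_R_NormedModule));
      [apply filterdiff_id | now intros [c d]].
Qed.

Lemma continuous_components (F : R -> R -> C) (u v : R) :
  continuous (fun q : R * R => F (fst q) (snd q)) (u, v) <->
  continuity_2d_pt (fun x y => Re (F x y)) u v /\
  continuity_2d_pt (fun x y => Im (F x y)) u v.
Proof.
  rewrite !continuity_2d_pt_filterlim; split.
  - intros H; split.
    + apply (continuous_comp (fun q : R * R => F (fst q) (snd q))
        (fun z : prod_UniformSpace R_UniformSpace R_UniformSpace => fst z));
        [exact H | apply continuous_fst].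
    + apply (continuous_comp (fun q : R * R => F (fst q) (snd q))
        (fun z : prod_UniformSpace R_UniformSpace R_UniformSpace => snd z));
        [exact H | apply continuous_snd].
  - intros [H1 H2]; apply filterlim_locally; intros eps.
    assert (K1 := proj1 (filterlim_locally _ _) H1 eps).
    assert (K2 := proj1 (filterlim_locally _ _) H2 eps).
    generalize (filter_and _ _ K1 K2); apply filter_imp.
    intros q [B1 B2]; split; assumption.
Qed.

Lemma class_S_components (n : nat) (U : R * R -> Prop) (k : R -> R -> C) :
  class_S n U k <->
  real_class_S n U (fun x y => Re (k x y)) /\ real_class_S n U (fun x y => Im (k x y)).
Proof.
  assert (Hu : forall i u v, ex_derive (V := C_R_NormedModule)
      (fun x => partial i 0 k x v) u <->
    ex_derive (fun x => rpartial i 0 (fun x y => Re (k x y)) x v) u /\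
    ex_derive (fun x => rpartial i 0 (fun x y => Im (k x y)) x v) u).
  { intros i u v; rewrite ex_derive_components.
    split; (intros [H1 H2]; split; [revert H1 | revert H2]; apply ex_derive_ext;
      intros t; now rewrite partial_components). }
  assert (Hv : forall i j u v, ex_derive (V := C_R_NormedModule)
      (fun y => partial i j k u y) v <->
    ex_derive (rpartial i j (fun x y => Re (k x y)) u) v /\
    ex_derive (rpartial i j (fun x y => Im (k x y)) u) v).
  { intros i j u v; rewrite ex_derive_components.
    split; (intros [H1 H2]; split; [revert H1 | revert H2]; apply ex_derive_ext;
      intros t; now rewrite partial_components). }
  assert (Hc : forall i j u v,
    continuous (fun q : R * R => partial i j k (fst q) (snd q)) (u, v) <->
    continuity_2d_pt (rpartial i j (fun x y => Re (k x y))) u v /\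
    continuity_2d_pt (rpartial i j (fun x y => Im (k x y))) u v).
  { intros i j u v; rewrite (continuous_components (partial i j k)).
    split; (intros [H1 H2]; split; [revert H1 | revert H2];
      apply continuity_2d_pt_ext; intros x y; now rewrite partial_components). }
  split.
  - intros H.
    assert (Du := fun i u v (Hi : (i < n)%nat) Huv => proj1 (Hu i u v)
      (proj1 (proj1 (H (S i) 0%nat Hi (Nat.le_0_l n))) i (le_n (S i)) u v Huv)).
    assert (Dv := fun i j u v (Hi : (i <= n)%nat) (Hj : (j < n)%nat) Huv =>
      proj1 (Hv i j u v)
      (proj2 (proj1 (H i (S j) Hi Hj)) j (le_n (S j)) u v Huv)).
    assert (Dc := fun i j u v (Hi : (i <= n)%nat) (Hj : (j <= n)%nat) Huv =>
      proj1 (Hc i j u v) (proj2 (H i j Hi Hj) (u, v) Huv)).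
    split; split.
    + exact (fun i u v Hi Huv => proj1 (Du i u v Hi Huv)).
    + exact (fun i j u v Hi Hj Huv => proj1 (Dv i j u v Hi Hj Huv)).
    + exact (fun i j u v Hi Hj Huv => proj1 (Dc i j u v Hi Hj Huv)).
    + exact (fun i u v Hi Huv => proj2 (Du i u v Hi Huv)).
    + exact (fun i j u v Hi Hj Huv => proj2 (Dv i j u v Hi Hj Huv)).
    + exact (fun i j u v Hi Hj Huv => proj2 (Dc i j u v Hi Hj Huv)).
  - intros [Hre Him] i j Hi Hj; split; [split |].
    + intros i' Hi' u v Huv; apply Hu.
      split; [apply (class_derive_u n U _ Hre) | apply (class_derive_u n U _ Him)];
        auto; lia.
    + intros j' Hj' u v Huv; apply Hv.
      split; [apply (class_derive_v n U _ Hre) | apply (class_derive_v n U _ Him)];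
        auto; lia.
    + intros [u v] Huv; apply Hc.
      split; [apply (class_continuous n U _ Hre) | apply (class_continuous n U _ Him)];
        auto.
Qed.

Theorem theorem3p20 :
  forall (n : nat) (Omega : R -> Prop) (k : R -> R -> C),
    (1 <= n)%nat ->
    open Omega ->
    (exists x, Omega x) ->
    positive_definite_kernel Omega k ->
    (exists U : R * R -> Prop,
        open U /\
        (forall p, U p -> square Omega p) /\
        (forall p, diagonal Omega p -> U p) /\
        class_S n U k) ->
    class_S n (square Omega) k.
Proof.
  intros n Omega k _ HO _ Hk [U [HU [_ [Hdiag Hn]]]].
  apply class_S_components in Hn; destruct Hn as [Hre _].
  assert (H := real_kernel_regularity n Omega (real_components k) U HO HU
    (fun x Hx => Hdiag (x, x) (conj Hx eq_refl)) (realified_positive Omega k Hk)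
    (fun e => match e with true => Hre | false => Hre end)).
  apply class_S_components; split; [apply (H true true) | apply (H true false)].
Qed.
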